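(* (1) Fix any sequences $b_n,\gamma_n>0$ such that $b_n/\gamma_n\to 0$. Then there exists a sequence $\epsilon_n\to 0$ such that \[\lim_{n \to \infty}\ \sup_{\substack{\mathcal{A}, P\text{ s.t. }\\ \beta_{1,n-1}^{*,\mathrm{out}}(\mathcal{A},P) \le b_{n}}}\mathbb{P}\left\{\alpha_{P}^{\gamma_n\text{-J+}}(\mathcal{D}_n)\geq \alpha + \epsilon_n\right\} =0.\] (2) For each $B>0$, let $\mathcal{P}_B$ be the set of distributions $P$ of $(X,Y)$ on $\mathcal{X}\times\mathbb{R}$ such that $Y\mid X$ has a conditional density $f_{Y|X}$ (with respect to Lebesgue measure) satisfying $\mathbb{E}[\sup_{y\in\mathbb{R}}f_{Y|X}(y\mid X)]\leq B$. Fix any sequences $b_n,B_n>0$ such that $b_n B_n\to 0$. Then there exists a sequence $\epsilon_n\to 0$ such that \[\lim_{n \to \infty}\ \sup_{\substack{\mathcal{A},P \text{ s.t. } P \in \mathcal{P}_{B_n},\\ \beta_{1,n-1}^{*,\mathrm{out}}(\mathcal{A},P) \le b_{n}}}\mathbb{P}\left\{\alpha_{P}^{\text{J+}}(\mathcal{D}_n)\geq \alpha + \epsilon_n\right\} =0.\] In both parts the supremum is over symmetric regression algorithms $\mathcal{A}$ and distributions $P$ on $\mathcal{X}\times\mathbb{R}$ satisfying the indicated constraints, and $\mathcal{D}_n=\{(X_i,Y_i)\}_{i\in[n]}$ is drawn i.i.d. from $P$.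
   Context: Write $[n]=\{1,\dots,n\}$. Let $\mathcal{X}$ be a measurable space. A regression algorithm is a map $\mathcal{A}:\bigcup_{n\geq 0}(\mathcal{X}\times\mathbb{R})^n\to\{\text{measurable functions }\mathcal{X}\to\mathbb{R}\}$. It is symmetric if for each $n\ge1$, each data set and each permutation $\pi$ of $[n]$, $\mathcal{A}((X_1,Y_1),\dots,(X_n,Y_n))=\mathcal{A}((X_{\pi(1)},Y_{\pi(1)}),\dots,(X_{\pi(n)},Y_{\pi(n)}))$. All quantities whose probabilities or expectations are taken are understood to be measurable. A target level $\alpha\in(0,1)$ is fixed. Quantile: for real $v_1,\dots,v_n$ and $\tau\in\mathbb{R}$, $\mathrm{Quantile}(\{v_i\}_{i\in[n]};\tau)=\inf\{t\in\mathbb{R}: \#\{i\in[n]: v_i\le t\}\ge \tau n\}$, equal to $+\infty$ if $\tau>1$. Inflated jackknife+: given $\mathcal{D}_n=\{(X_i,Y_i)\}_{i\in[n]}$, let $\widehat\mu_{-i}=\mathcal{A}(\{(X_j,Y_j)\}_{j\in[n]\setminus\{i\}})$ and $R_i=|Y_i-\widehat\mu_{-i}(X_i)|$ for $i\in[n]$. For $\gamma\ge 0$, the $\gamma$-inflated jackknife+ interval at $x$ is \[\widehat{C}^{\gamma\text{-J+}}_n(x)=\Big[-\mathrm{Quantile}\big(\{-\widehat\mu_{-i}(x)+R_i\}_{i\in[n]};(1-\alpha)(1+1/n)\big)-\gamma,\ \mathrm{Quantile}\big(\{\widehat\mu_{-i}(x)+R_i\}_{i\in[n]};(1-\alpha)(1+1/n)\big)+\gamma\Big]\]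 (as a subset of $\mathbb{R}$, empty if the lower endpoint exceeds the upper). The jackknife+ interval $\widehat{C}^{\text{J+}}_n(x)$ is the case $\gamma=0$. The training-conditional miscoverage rates are $\alpha_P^{\gamma\text{-J+}}(\mathcal{D}_n)=\mathbb{P}\{Y_{n+1}\notin\widehat{C}^{\gamma\text{-J+}}_n(X_{n+1})\mid\mathcal{D}_n\}$ and $\alpha_P^{\text{J+}}(\mathcal{D}_n)=\mathbb{P}\{Y_{n+1}\notin\widehat{C}^{\text{J+}}_n(X_{n+1})\mid\mathcal{D}_n\}$, where $(X_{n+1},Y_{n+1})\sim P$ is independent of $\mathcal{D}_n$. Out-of-sample $1$-stability: for $n\ge0$, $\beta^{\mathrm{out}}_{1,n}(\mathcal{A},P)=\mathbb{E}[|\widehat\mu_n(X)-\widehat\mu_{n+1}(X)|]$, where $\widehat\mu_k=\mathcal{A}((X_1,Y_1),\dots,(X_k,Y_k))$ and $(X_1,Y_1),\dots,(X_{n+1},Y_{n+1}),(X,Y)$ are i.i.d. from $P$. Define $\beta^{*,\mathrm{out}}_{1,n}(\mathcal{A},P)=\sup_{n'\ge n}\beta^{\mathrm{out}}_{1,n'}(\mathcal{A},P)$. *)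

(* Defs.v *)
From HB Require Import structures.
From mathcomp Require Import all_boot all_order all_fingroup all_algebra.
From mathcomp Require Import all_classical all_reals all_analysis.
From mathcomp Require Import measurable_realfun.

Set Implicit Arguments.
Unset Strict Implicit.
Unset Printing Implicit Defensive.

Import Order.TTheory GRing.Theory Num.Theory.
Import numFieldNormedType.Exports.

Local Open Scope classical_set_scope.
Local Open Scope ring_scope.

(* The law on [n.-tuple T] of [n] i.i.d. draws from [P], built by pushing
   [P \x P^n] forward along [cons]; [iid_box] below characterizes it. *)
Section iid.
Context {d} {T : measurableType d} {R : realType}.

Definition tuple_cons n (z : T * n.-tuple T) : n.+1.-tuple T :=
  [tuple of z.1 :: z.2].

Lemma measurable_tuple_cons n : measurable_fun setT (@tuple_cons n).
Proof. exact: (measurable_cons measurable_fst measurable_snd). Qed.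

HB.instance Definition _ n :=
  isMeasurableFun.Build _ _ _ _ (@tuple_cons n) (@measurable_tuple_cons n).

Fixpoint iid (P : probability T R) n : probability (n.-tuple T) R :=
  match n with
  | 0 => dirac [tuple]
  | m.+1 => distribution (P \x iid P m)%E (@tuple_cons m)
  end.

Lemma iid_box (P : probability T R) n (B : 'I_n -> set T) :
  (forall i, measurable (B i)) ->
  iid P n [set D | forall i, B i (tnth D i)] = (\prod_(i < n) P (B i))%E.
Proof.
elim: n B => [|n IHn] B mB.
  rewrite big_ord0 /= diracE mem_set//.
  by move=> [].
rewrite big_ord_recl -IHn//=.
rewrite /distribution /pushforward -product_measure1E//; last first.
  rewrite (_ : mkset _ =
    \bigcap_(i in [set: 'I_n]) ((@tnth _ T)^~ i @^-1` B (lift ord0 i))).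
    apply: fin_bigcap_measurable => // i _.
    by rewrite -[X in measurable X]setTI; exact: measurable_tnth.
  by apply/seteqP; split => D BD i; [move=> _; exact: BD|exact: BD].
congr (_ _); apply/seteqP; split => -[x D] /=.
  move=> BD; split; first by have := BD ord0; rewrite /tuple_cons tnth0.
  by move=> i; have := BD (lift ord0 i); rewrite tnthS.
move=> [Bx BD] i; case: (unliftP ord0 i) => [j|] ->.
  by rewrite tnthS.
by rewrite tnth0.
Qed.

End iid.

Section jackknife.
Context {d} {X : measurableType d} {R : realType}.
Implicit Types (P : probability (X * R)%type R) (alpha gamma : R).

(* [seq (X * R)] is the disjoint union over [n >= 0] of the [(X * R)^n]. *)
Definition algorithm := seq (X * R) -> {mfun X >-> R}.

Implicit Types A : algorithm.

Definition symmetric_algorithm A := forall n (D : n.-tuple (X * R)) (s : 'S_n),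
  A [tuple tnth D (s i) | i < n] =1 A D.

(* Joint measurability in (data set, test point): the standing convention that
   every quantity whose probability or expectation is taken is measurable. *)
Definition measurable_algorithm A := forall n,
  measurable_fun [set: n.-tuple (X * R) * X] (fun z => A z.1 z.2).

Definition quantile n (v : 'I_n -> R) (tau : R) : \bar R :=
  if 1 < tau then +oo%E
  else ereal_inf [set t%:E | t in [set t : R |
         tau * n%:R <= #|[set i | v i <= t]%SET|%:R]].

Definition loo_fit A n (D : n.-tuple (X * R)) (i : 'I_n) : {mfun X >-> R} :=
  A [seq tnth D j | j <- enum 'I_n & j != i].

Definition loo_residual A n (D : n.-tuple (X * R)) (i : 'I_n) : R :=
  `|(tnth D i).2 - loo_fit A D i (tnth D i).1|.

Definition inflated_jackknife_plus alpha gamma A n (D : n.-tuple (X * R))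
    (x : X) : set R :=
  let tau := (1 - alpha) * (1 + n%:R^-1) in
  let lo := quantile (fun i => - loo_fit A D i x + loo_residual A D i) tau in
  let hi := quantile (fun i => loo_fit A D i x + loo_residual A D i) tau in
  [set y | (- lo - gamma%:E <= y%:E <= hi + gamma%:E)%E].

Definition jackknife_plus alpha A n (D : n.-tuple (X * R)) (x : X) : set R :=
  inflated_jackknife_plus alpha 0 A D x.

(* The test point is independent of the data, so conditioning on the data set
   amounts to fixing it. *)
Definition miscoverage P n (C : n.-tuple (X * R) -> X -> set R)
    (D : n.-tuple (X * R)) : \bar R :=
  P [set z | ~ C D z.1 z.2].

Definition beta_out A P n : \bar R :=
  'E_((iid P n.+1 \x P)%E)[fun z => `|A (take n z.1) z.2.1 - A z.1 z.2.1|].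

Definition beta_out_star A P n : \bar R :=
  ereal_sup [set beta_out A P m | m in [set m | (n <= m)%N]].

(* [f x] is the density of [Y] given [X = x], for the pair [(X, Y)] of law [P];
   [P (S `*` setT)] is the probability that [X] is in [S], so that [f x]
   integrates to 1 for almost all [x]. *)
Definition conditional_density P (f : X -> R -> R) :=
  [/\ forall x y, 0 <= f x y,
      measurable_fun [set: X * R] (fun z => f z.1 z.2) &
      forall (S : set X) (B : set R), measurable S -> measurable B ->
        P (S `*` B) = (\int[P]_(z in S `*` setT)
                         \int[lebesgue_measure]_(y in B) (f z.1 y)%:E)%E].

Definition sup_density (f : X -> R -> R) (x : X) : \bar R :=
  ereal_sup [set (f x y)%:E | y in [set: R]].

(* The uncountable supremum need not be measurable in [x], so its measurability
   is required for the expectation to make sense. *)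
Definition bounded_density (B : R) P := exists f : X -> R -> R,
  [/\ conditional_density P f,
      measurable_fun [set: X] (sup_density f) &
      (\int[P]_z sup_density f z.1 <= B%:E)%E].

End jackknife.
Arguments algorithm {d} X R.

(* Main.v *)
Require Import Defs.
From HB Require Import structures.
From mathcomp Require Import all_boot all_order all_fingroup all_algebra.
From mathcomp Require Import all_classical all_reals all_analysis.
From mathcomp Require Import measurable_realfun.
From mathcomp Require Import primitive_action alt.
From mathcomp Require Import zify lra ring.

Set Implicit Arguments.
Unset Strict Implicit.
Unset Printing Implicit Defensive.

Import Order.TTheory GRing.Theory Num.Theory.
Import numFieldNormedType.Exports.

Local Open Scope classical_set_scope.
Local Open Scope ring_scope.

(** The miscoverage rate alpha_P(D) is controlled through its k-th moment, for a
large fixed number k of test points.  Given D, the k test points are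
independent, so all of them are miscovered with probability alpha_P(D)^k, and by
Markov's inequality

  c^k * P(alpha_P(D) >= c) <= P(all k test points are miscovered)

([iid_held_out_power]).  The right-hand side is compared with an exchangeable
situation.  Among the N = k + n points (test points and training points
together), let R_i be the residual of point i for the model fitted to the N - 1
other points.  These residuals are exchangeable, and at most N - c points can
have at least c residuals strictly below their own; so the k test points are all
among these top points with probability at most about (1 - c/N)^k
([exchangeable_top_set]).

A test point that the inflated interval misses is a top point with
c = (1 - alpha - delta) n, unless the fits involved have moved a lot
([miscovered_top]): the jackknife+ compares residuals of models fitted to n - 1
training points, and each of these models differs from the exchangeable one by
the addition of k training points.  By stability and the triangle inequality one
such change has mean at most k b ([integral_loo_fit_le]), so Markov's inequality
shows that the moves exceed the slack gamma too often with probability at most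
2 k^2 b / (delta gamma).  Together ([jackknife_tail_bound]),

  c^k * P(alpha_P(D) >= c)
    <= (alpha + delta + k/n)^k + 2 k^2 b / (delta gamma).

For c = alpha + e, take delta = e/4 and k so large that
((alpha + e/2) / (alpha + e))^k is small, then n large: the probability tends to
0 uniformly in the algorithm and the distribution, for each fixed e
([jackknife_tail_vanishes]).  A diagonal choice of e gives the sequence eps_n
([diagonal_rate]).

For the second part, inflating by gamma on either side adds to the interval a
set of Lebesgue measure at most 2 gamma, hence of probability at most 2 gamma B
([miscoverage_deflate]).  With gamma = sqrt(b/B), both b/gamma and gamma B equal
sqrt(b B), which tends to 0, and the first part applies
([jackknife_plus_tail_vanishes]). *)

(** * The law of a selection of i.i.d. draws *)

Definition tuple_select (T : Type) m n (f : 'I_m -> 'I_n) (t : n.-tuple T) :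
    m.-tuple T :=
  [tuple tnth t (f i) | i < m].

Section iid_selection.
Context {d} {T : measurableType d} {R : realType}.
Implicit Types P : probability T R.

Definition tuple_box n (B : 'I_n -> set T) : set (n.-tuple T) :=
  [set D | forall i, B i (tnth D i)].

Lemma measurable_tuple_box n (B : 'I_n -> set T) :
  (forall i, measurable (B i)) -> measurable (tuple_box B).
Proof.
move=> mB; rewrite (_ : tuple_box B =
    \bigcap_(i in [set: 'I_n]) ((@tnth _ T)^~ i @^-1` B i)).
  apply: fin_bigcap_measurable => // i _.
  by rewrite -[X in measurable X]setTI; exact: measurable_tnth.
by apply/seteqP; split => D BD i; [move=> _; exact: BD|exact: BD].
Qed.

Definition tuple_boxes n : set (set (n.-tuple T)) :=
  [set A | exists2 B, (forall i, measurable (B i)) & A = tuple_box B].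

(** Boxes are a generating pi-system, so that a law on tuples is determined by
    its values on boxes. *)
Lemma sigma_tuple_boxes n :
  (@measurable _ (n.-tuple T)) = <<s @tuple_boxes n >>.
Proof.
apply/seteqP; split; last first.
  apply: smallest_sub; first exact: sigma_algebra_measurable.
  by move=> _ [B mB ->]; exact: measurable_tuple_box.
apply: smallest_sub; first exact: smallest_sigma_algebra.
rewrite -bigcup_seq => _ [i _ [B mB <-]].
apply: sub_sigma_algebra.
exists (fun j => if j == i then B else setT).
  by move=> j; case: ifP.
rewrite setTI; apply/seteqP; split => t /=.
  by move=> Bt j /=; case: eqP => // ->.
by move=> /(_ i); rewrite eqxx.
Qed.

Lemma setI_tuple_boxes n : setI_closed (@tuple_boxes n).
Proof.
move=> _ _ [B mB ->] [C mC ->]; exists (fun i => B i `&` C i).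
  by move=> i; exact: measurableI.
by apply/seteqP; split => [t [Bt Ct] i|t BC]; split => //= i; case: (BC i).
Qed.

Lemma measurable_tuple_select m n (f : 'I_m -> 'I_n) :
  measurable_fun setT (@tuple_select T _ _ f).
Proof.
apply/measurable_fun_tnthP => i.
rewrite (_ : _ \o _ = (@tnth _ T)^~ (f i)); first exact: measurable_tnth.
by apply/funext => t /=; rewrite tnth_mktuple.
Qed.

HB.instance Definition _ m n (f : 'I_m -> 'I_n) :=
  isMeasurableFun.Build _ _ _ _ (@tuple_select T _ _ f)
    (measurable_tuple_select f).

(** Invariance of the i.i.d. law under permutations, and its marginals, at once:
    on a box the coordinates outside the range of [f] are unconstrained and
    contribute a factor 1. *)
Lemma iid_select P m n (f : 'I_m -> 'I_n) (F : set (m.-tuple T)) :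
  injective f -> measurable F ->
  iid P n (tuple_select f @^-1` F) = iid P m F.
Proof.
move=> injf mF.
pose m1 : probability _ _ := distribution (iid P n) (tuple_select f).
rewrite -[LHS]/(m1 F).
apply: (@measure_unique _ _ _ (@tuple_boxes m) (fun=> setT)) => //.
- exact: sigma_tuple_boxes.
- exact: setI_tuple_boxes.
- by move=> _; exists (fun=> setT) => //; apply/seteqP; split.
- by rewrite bigcup_const.
- move=> _ [B mB ->].
  (* [C j] is the constraint on coordinate [j] of the longer tuple. *)
  pose C j := if [pick i | f i == j] is Some i then B i else setT.
  have Cf i : C (f i) = B i.
    rewrite /C; case: pickP => [i' /eqP/injf -> //|/(_ i)].
    by rewrite eqxx.
  have mC j : measurable (C j) by rewrite /C; case: pickP.
  have preimC : tuple_select f @^-1` tuple_box B = tuple_box C.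
    apply/seteqP; split => t /=.
      move=> Bt j; rewrite /C; case: pickP => // i /eqP <-.
      by have := Bt i; rewrite tnth_mktuple.
    by move=> Ct i; rewrite tnth_mktuple -Cf.
  rewrite -[LHS]/(iid P n (tuple_select f @^-1` tuple_box B)) preimC !iid_box //.
  rewrite (bigID [in codom f]) /= [X in (_ * X)%E]big1 ?mule1; last first.
    move=> j jf; rewrite /C; case: pickP => [i /eqP fij|_]; last first.
      exact: probability_setT.
    by rewrite -fij codom_f in jf.
  rewrite -big_uniq /=; last by rewrite map_inj_uniq// enum_uniq.
  rewrite big_map big_enum [RHS]iid_box//; apply: eq_bigr => i _; congr (P _).
  exact: Cf.
- by move=> _; rewrite [X in (X < _)%E](probability_setT m1) ltry.
Qed.

Lemma ge0_integral_iid_select P m n (f : 'I_m -> 'I_n)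
    (g : m.-tuple T -> \bar R) :
  injective f -> measurable_fun setT g -> (forall t, 0 <= g t)%E ->
  (\int[iid P n]_t g (tuple_select f t) = \int[iid P m]_t g t)%E.
Proof.
move=> injf mg g0.
have /= <- := ge0_integral_pushforward (measurable_tuple_select f)
  (iid P n) measurableT mg (fun t _ => g0 t).
apply: eq_measure_integral => A mA _; exact: iid_select.
Qed.

End iid_selection.

(** * Stability over the addition of several training points *)

Section product_swap.
Context {d1 d2} {T1 : measurableType d1} {T2 : measurableType d2} {R : realType}.

Lemma ge0_integral_product_swap (P : probability T1 R) (Q : probability T2 R)
    (g : T1 * T2 -> \bar R) :
  measurable_fun setT g -> (forall z, 0 <= g z)%E ->
  (\int[P \x Q]_z g z = \int[Q \x P]_z g (z.2, z.1))%E.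
Proof.
move=> mg g0; rewrite fubini_tonelli2// fubini_tonelli1//.
exact: (measurableT_comp mg (measurable_fun_pair measurable_snd measurable_fst)).
Qed.

End product_swap.

Section training.
Context {d} {X : measurableType d} {R : realType}.
Implicit Types (A : algorithm X R) (P : probability (X * R)%type R).

Lemma symmetric_algorithm_perm A : symmetric_algorithm A ->
  forall s1 s2 : seq (X * R), perm_eq s1 s2 -> A s1 =1 A s2.
Proof.
move=> symA s1 s2 s12 x.
have /tuple_permP[p ->] : perm_eq s1 (in_tuple s2) by [].
exact: symA.
Qed.

Lemma measurable_fit A : measurable_algorithm A ->
  forall d' (Om : measurableType d') m (u : Om -> m.-tuple (X * R))
    (v : Om -> X),
  measurable_fun setT u -> measurable_fun setT v ->
  measurable_fun setT (fun w => A (u w) (v w)).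
Proof.
move=> mA d' Om m u v mu mv.
exact: (measurableT_comp (mA m) (measurable_fun_pair mu mv)).
Qed.

Definition fit_on A N (t : N.-tuple (X * R)) (s : seq 'I_N) : {mfun X >-> R} :=
  A [seq tnth t i | i <- s].

Lemma tuple_select_tnth (T : Type) N m (s : m.-tuple 'I_N) (t : N.-tuple T) :
  tuple_select (tnth s) t = [seq tnth t i | i <- s] :> seq T.
Proof.
by rewrite /tuple_select /= -[in RHS](map_tnth_enum s) -map_comp.
Qed.

Lemma measurable_fit_on A : measurable_algorithm A ->
  forall N d' (Om : measurableType d') (s : seq 'I_N)
    (u : Om -> N.-tuple (X * R)) (v : Om -> X),
  measurable_fun setT u -> measurable_fun setT v ->
  measurable_fun setT (fun w => fit_on A (u w) s (v w)).
Proof.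
move=> mA N d' Om s u v mu mv.
rewrite (_ : (fun w => _) =
    fun w => A (tuple_select (tnth (in_tuple s)) (u w)) (v w)); last first.
  by apply/funext => w; rewrite /fit_on tuple_select_tnth.
apply: measurable_fit => //.
exact: (measurableT_comp (measurable_tuple_select _) mu).
Qed.

Lemma tuple_select_widen (T : pointedType) m n (mn : (m <= n)%N) (t : n.-tuple T) :
  tuple_select (widen_ord mn) t = take m t :> seq T.
Proof.
have szt : size (take m t) = m by rewrite size_takel // size_tuple.
apply: (@eq_from_nth _ point); first by rewrite szt size_tuple.
move=> i; rewrite size_tuple => im.
rewrite nth_take// -(tnth_nth _ _ (widen_ord mn (Ordinal im))).
by rewrite -(tnth_nth _ _ (Ordinal im)) tnth_mktuple.
Qed.

Lemma measurable_testpoint N (j : 'I_N) :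
  measurable_fun setT (fun t : N.-tuple (X * R) => (tnth t j).1).
Proof. exact: (measurableT_comp measurable_fst (measurable_tnth j)). Qed.

(** The quantity in [beta_out] does not depend on where the training points and
    the test point sit in a longer i.i.d. sample. *)
Lemma integral_one_point_update A P N m (s : m.-tuple 'I_N) (l j : 'I_N) :
  measurable_algorithm A -> uniq (j :: rcons s l) ->
  (\int[iid P N]_t `|fit_on A t s (tnth t j).1
                     - fit_on A t (rcons s l) (tnth t j).1|%:E
   = beta_out A P m)%E.
Proof.
move=> mA usjl.
pose g (z : (X * R) * m.+1.-tuple (X * R)) : \bar R :=
  (`|A (take m z.2) z.1.1 - A z.2 z.1.1|%:E)%E.
have mg : measurable_fun setT g.
  have m11 : measurable_fun setT
      (fun z : (X * R) * m.+1.-tuple (X * R) => z.1.1).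
    exact: (measurableT_comp measurable_fst measurable_fst).
  apply/measurable_EFinP/measurableT_comp => //.
  apply: measurable_funB; last exact: measurable_fit.
  under eq_fun do rewrite -(tuple_select_widen (leqnSn m)).
  apply: measurable_fit => //.
  exact: (measurableT_comp (measurable_tuple_select _) measurable_snd).
have g0 z : (0 <= g z)%E by rewrite lee_fin.
rewrite /beta_out unlock.
transitivity (\int[P \x iid P m.+1]_z g z)%E; last first.
  exact: ge0_integral_product_swap.
pose h (t : m.+2.-tuple (X * R)) : \bar R := g (thead t, [tuple of behead t]).
have mh : measurable_fun setT h.
  apply: (measurableT_comp mg); apply/measurable_fun_pair.
    by apply: (measurable_tnth ord0).
  exact: measurable_behead.
have h0 t : (0 <= h t)%E by exact: g0.
transitivity (\int[iid P m.+2]_t h t)%E; last first.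
  by rewrite ge0_integral_pushforward.
pose f := tnth [tuple of j :: rcons s l].
have injf : injective f by apply/tuple_uniqP.
rewrite -(ge0_integral_iid_select P injf mh h0).
apply: eq_integral => t _.
have selE : [seq tnth t (f i) | i <- enum 'I_m.+2] =
    tnth t j :: [seq tnth t i | i <- rcons s l].
  exact: (tuple_select_tnth [tuple of j :: rcons s l]).
rewrite /h /g /fit_on /= selE /= map_rcons -cats1.
by rewrite take_size_cat ?size_map ?size_tuple// /thead tnth_mktuple /f tnth0.
Qed.

(** Training points are added one at a time: the triangle inequality costs one
    [beta_out] per added point, at sizes that only increase. *)
Lemma integral_update_le A P N (s s' : seq 'I_N) (j : 'I_N) (b : R) :
  measurable_algorithm A -> uniq (j :: s ++ s') ->
  (forall m, (size s <= m)%N -> beta_out A P m <= b%:E)%E ->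
  (\int[iid P N]_t `|fit_on A t s (tnth t j).1
                     - fit_on A t (s ++ s') (tnth t j).1|%:E
   <= ((size s')%:R * b)%:E)%E.
Proof.
move=> mA.
have mfit (s1 : seq 'I_N) :
    measurable_fun setT (fun t => fit_on A t s1 (tnth t j).1).
  by apply: measurable_fit_on => //; exact: measurable_testpoint.
have mdist (s1 s2 : seq 'I_N) : measurable_fun setT (fun t =>
    `|fit_on A t s1 (tnth t j).1 - fit_on A t s2 (tnth t j).1|%:E).
  by apply/measurable_EFinP/measurableT_comp => //; exact: measurable_funB.
elim: s' s => [|l s' IHs'] s.
  rewrite cats0 mul0r => _ _.
  by under eq_integral do rewrite subrr normr0; rewrite integral0.
rewrite -cat_rcons => us betab.
apply: (@le_trans _ _ (\int[iid P N]_t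
    (`|fit_on A t s (tnth t j).1 - fit_on A t (rcons s l) (tnth t j).1|%:E +
     `|fit_on A t (rcons s l) (tnth t j).1
       - fit_on A t (rcons s l ++ s') (tnth t j).1|%:E))%E).
  apply: ge0_le_integral => //=.
  - exact: emeasurable_funD.
  - by move=> t _; rewrite -EFinD lee_fin ler_distD.
rewrite ge0_integralD//=; [|by move=> *; rewrite lee_fin..].
rewrite /= -nat1r mulrDl mul1r EFinD; apply: leeD.
  have -> := @integral_one_point_update A P N _ (in_tuple s) l j mA.
    exact: betab.
  by move: us; rewrite /= cat_uniq mem_cat => /andP[/norP[-> _] /andP[->]].
by apply: IHs' => // m; rewrite size_rcons => sm; apply: betab; exact: ltnW.
Qed.

(** By symmetry the leave-one-out fit at [j] is the fit on [s] followed by the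
    missing points, in any order. *)
Lemma integral_loo_fit_le A P N (s : seq 'I_N) (j : 'I_N) (b : R) :
  symmetric_algorithm A -> measurable_algorithm A -> uniq (j :: s) ->
  (forall m, (size s <= m)%N -> beta_out A P m <= b%:E)%E ->
  (\int[iid P N]_t `|fit_on A t s (tnth t j).1 - loo_fit A t j (tnth t j).1|%:E
   <= ((N - (size s).+1)%:R * b)%:E)%E.
Proof.
move=> symA mA /[dup] us /andP[js us'] betab.
pose s' := [seq i <- enum 'I_N | i \notin j :: s].
have ujs : uniq (j :: s ++ s').
  rewrite -cat_cons cat_uniq us filter_uniq ?enum_uniq// andbT.
  by apply/hasPn => i; rewrite mem_filter => /andP[].
have perm_all : perm_eq ((j :: s) ++ s') (enum 'I_N).
  apply: uniq_perm => //; first exact: enum_uniq.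
  by move=> i; rewrite mem_cat mem_filter mem_enum andbT orbN.
have size_s' : (size s' = N - (size s).+1)%N.
  have := perm_size perm_all; rewrite size_cat size_enum_ord => {2}<-.
  by rewrite addKn.
rewrite -size_s'; apply: le_trans (integral_update_le mA ujs betab).
rewrite le_eqVlt; apply/orP; left; apply/eqP.
apply: eq_integral => t _; congr (`|_ - _|%:E).
apply: symmetric_algorithm_perm => //; apply: perm_map.
apply: uniq_perm; first by rewrite filter_uniq ?enum_uniq.
  by case/andP: ujs.
move=> i; rewrite mem_filter mem_enum andbT mem_cat mem_filter mem_enum andbT.
rewrite inE negb_or; case: eqVneq => [->|_] /=; last by rewrite orbN.
by rewrite orbF (negbTE js).
Qed.
End training.

(** * Exchangeability of ranks *)

Section finite_predicates.
Context {d} {Om : measurableType d}.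

(** An event that depends on finitely many measurable bits is a finite union of
    the atoms that these bits generate; counts and ranks are of this kind. *)
Lemma measurable_finite_pred (I : finType) (b : I -> Om -> bool)
    (Q : pred {set I}) :
  (forall i, measurable [set w | b i w]) ->
  measurable [set w | Q [set i | b i w]%SET].
Proof.
move=> mb.
rewrite (_ : mkset _ = \bigcup_(S in [set S | Q S])
    \bigcap_(i in [set: I]) [set w | b i w = (i \in S)]).
  apply: fin_bigcup_measurable => [|S _].
    exact: finite_finset.
  apply: fin_bigcap_measurable => // i _.
  case: (i \in S); first exact: mb.
  rewrite (_ : mkset _ = ~` [set w | b i w]); first exact: measurableC.
  by apply/seteqP; split => w /=; case: (b i w).
apply/seteqP; split => [w Qw|w [S QS] bS] /=.
  by exists [set i | b i w]%SET => // i _ /=; rewrite inE.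
suff -> : [set i | b i w]%SET = S by [].
by apply/setP => i; rewrite inE; exact: bS.
Qed.

End finite_predicates.

(** This is the k-transitivity of the symmetric group. *)
Lemma perm_extends_injections k N (f g : 'I_k -> 'I_N) :
  injective f -> injective g -> exists s : 'S_N, forall j, s (f j) = g j.
Proof.
move=> injf injg.
have kN : (k <= N)%N.
  by have := leq_card f injf; rewrite !card_ord.
have trans : [transitive^k 'Sym_('I_N), on [set: 'I_N]%SET | 'P].
  by apply: ntransitive_weak (Sym_trans 'I_N); rewrite card_ord.
have dtupleE (h : 'I_k -> 'I_N) : injective h ->
    [tuple h j | j < k] \in k.-dtuple([set: 'I_N]%SET).
  move=> injh; rewrite inE map_inj_uniq ?enum_uniq//=; apply/subsetP => i _.
have [s _ sfg] := atransP2 trans (dtupleE f injf) (dtupleE g injg).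
exists s => j; have /(congr1 (fun t => tnth t j)) := sfg.
rewrite tnth_mktuple tnth_map.
by rewrite tnth_mktuple => ->.
Qed.

Section top_ranks.
Context {R : realType}.

Definition top_set N (c : R) (r : 'I_N -> R) : {set 'I_N} :=
  [set j | c <= #|[set i | r i < r j]%SET|%:R]%SET.

(** The points strictly below a minimal member of the top set are outside it, and
    there are at least [c] of them. *)
Lemma card_top_set N (c : R) (r : 'I_N -> R) : c <= N%:R ->
  #|top_set c r|%:R <= N%:R - c.
Proof.
move=> cN; have [->|[j0 j0T]] := set_0Vmem (top_set c r).
  by rewrite cards0 subr_ge0.
pose j := [arg min_(j < j0 in top_set c r) r j]%O.
have [jT jmin] : j \in top_set c r /\
    forall i, i \in top_set c r -> r j <= r i.
  by rewrite /j; case: arg_minP => // i ? ?; split.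
pose L := [set i | r i < r j]%SET.
have cL : c <= #|L|%:R by move: jT; rewrite inE.
have LT : [disjoint top_set c r & L]%B.
  rewrite -setI_eq0; apply/eqP/setP => i; rewrite !inE; apply/negbTE/negP.
  by move=> /andP[iT]; rewrite ltNge jmin// inE.
rewrite lerBrDr; apply: (@le_trans _ _ (#|top_set c r| + #|L|)%:R).
  by rewrite natrD lerD2l.
move: LT; rewrite -(leq_card_setU (top_set c r) L).2 => /eqP <-.
by rewrite ler_nat -[leqRHS](card_ord N) max_card.
Qed.

Lemma top_set_perm N (c : R) (r : 'I_N -> R) (s : 'S_N) (j : 'I_N) :
  (j \in top_set c (r \o s)) = (s j \in top_set c r).
Proof.
rewrite !inE -[in RHS](card_preimset _ (@perm_inj _ s)).
rewrite (_ : [set i | (r \o s) i < (r \o s) j]%SET =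
  (s @^-1: [set i | r i < r (s j)])%SET)//.
by apply/setP => i; rewrite !inE.
Qed.

Lemma card_injections_into k N (S : {set 'I_N}) :
  (#|[set g : {ffun 'I_k -> 'I_N} | injectiveb g &
       [forall j, g j \in S]]%SET| <= #|S| ^ k)%N.
Proof.
rewrite -[X in (_ <= _ ^ X)%N](card_ord k) -card_ffun_on.
apply: subset_leq_card; apply/fintype.subsetP => g; rewrite inE => /andP[_ /forallP gS].
exact/ffun_onP.
Qed.

End top_ranks.

Section exchangeable.
Context {d} {T : measurableType d} {R : realType}.

Lemma measurable_top_set N (r : N.-tuple T -> 'I_N -> R) (c : R)
    (Q : pred {set 'I_N}) :
  (forall i, measurable_fun setT (r ^~ i)) ->
  measurable [set t | Q (top_set c (r t))].
Proof.
move=> mr.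
pose b (p : 'I_N * 'I_N) t := r t p.1 < r t p.2.
pose top (S : {set 'I_N * 'I_N}) :=
  [set j | c <= #|[set i | (i, j) \in S]%SET|%:R]%SET.
rewrite (_ : mkset _ = [set t | Q (top [set p | b p t]%SET)]).
  apply: (@measurable_finite_pred _ _ _ b (Q \o top)) => -[i j].
  rewrite -[X in measurable X]setTI; exact: measurable_fun_ltr.
suff topE t : top [set p | b p t]%SET = top_set c (r t).
  by apply/seteqP; split => t /=; rewrite topE.
apply/setP => j; rewrite !inE; congr (_ <= _%:R).
by apply: eq_card => i; rewrite !inE.
Qed.

(** All [N ^_ k] injective choices of [k] indices are equally likely to fall
    entirely in the top set, and for each outcome at most [#|top_set| ^ k] of them
    do. *)
Lemma exchangeable_top_set (P : probability T R) k N
    (r : N.-tuple T -> 'I_N -> R) (c : R) (f : 'I_k -> 'I_N) :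
  injective f -> c <= N%:R ->
  (forall i, measurable_fun setT (r ^~ i)) ->
  (forall (s : 'S_N) t i, r (tuple_select s t) i = r t (s i)) ->
  ((N ^_ k)%:R%:E * iid P N [set t | forall j, f j \in top_set c (r t)]
   <= ((N%:R - c) ^+ k)%:E)%E.
Proof.
move=> injf cN mr eqr.
pose E (g : {ffun 'I_k -> 'I_N}) :=
  [set t | [forall j, g j \in top_set c (r t)]].
have mE g : measurable (E g).
  exact: (measurable_top_set c (fun S => [forall j, g j \in S]) mr).
have -> : [set t | forall j, f j \in top_set c (r t)] = E (finfun f).
  apply/seteqP; split => t /=.
    by move=> fT; apply/forallP => j; rewrite ffunE.
  by move=> /forallP fT j; have := fT j; rewrite ffunE.
pose inj := [set g : {ffun 'I_k -> 'I_N} | injectiveb g]%SET.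
have probE g : g \in inj ->
    iid P N (E g) = iid P N (E (finfun f)).
  rewrite inE => /injectiveP injg.
  have [s sfg] := perm_extends_injections injf injg.
  rewrite -(iid_select P (@perm_inj _ s) (mE (finfun f))).
  congr (iid P N _); apply/seteqP; split => t /= /forallP gT;
    apply/forallP => j; move: (gT j); rewrite -?sfg ffunE;
    rewrite -top_set_perm; congr (is_true (_ \in top_set _ _));
    by apply/funext => i; rewrite /= eqr.
have <- : (\sum_(g in inj) iid P N (E g) =
    (N ^_ k)%:R%:E * iid P N (E (finfun f)))%E.
  rewrite (eq_bigr _ probE).
  rewrite -[iid P N _]fineK ?fin_num_measure//.
  by rewrite sumEFin sumr_const card_inj_ffuns !card_ord -EFinM mulr_natl.
rewrite (eq_bigr (fun g => \int[iid P N]_t (\1_(E g) t)%:E)%E); last first.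
  by move=> g _; rewrite integral_indic// setIT.
have m1 g : measurable_fun setT (fun t => (\1_(E g) t)%:E : \bar R).
  exact/measurable_EFinP/measurable_indic.
rewrite -big_enum -ge0_integral_sum//=.
apply: (@le_trans _ _ (\int[iid P N]_t (cst ((N%:R - c) ^+ k)%:E t))%E).
  apply: ge0_le_integral => //=.
  - by move=> t _; apply: sume_ge0 => g _; rewrite lee_fin.
  - by apply: emeasurable_sum.
  - move=> t _; rewrite sumEFin lee_fin big_enum/=.
    have -> : \sum_(g in inj) \1_(E g) t = #|[set g : {ffun 'I_k -> 'I_N} |
        injectiveb g & [forall j, g j \in top_set c (r t)]]%SET|%:R :> R.
      rewrite -sum1_card natr_sum [RHS](eq_bigl (fun g =>
        (g \in inj) && [forall j, g j \in top_set c (r t)])); last first.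
        by move=> g; rewrite !inE.
      rewrite big_mkcondr; apply: eq_bigr => g _.
      rewrite indicE; case: ifPn => gT; first by rewrite mem_set.
      by rewrite memNset//; exact/negP.
    apply: le_trans (_ : (#|top_set c (r t)| ^ k)%:R <= _).
      by rewrite ler_nat card_injections_into.
    by rewrite natrX lerXn2r ?nnegrE ?subr_ge0 ?card_top_set.
by rewrite integral_cst// [X in (_ * X)%E]probability_setT mule1.
Qed.

End exchangeable.

(** * Held-out points and miscoverage *)

Section held_out.
Context {d} {T : measurableType d} {R : realType}.
Implicit Types P : probability T R.

(** The test points come first because [iid] adds each new draw at the front, so
    that induction on [k] adds one test point to a fixed training set. *)
Definition training_part k n (t : (k + n).-tuple T) : n.-tuple T :=
  tuple_select (@rshift k n) t.

Lemma measurable_training_part k n : measurable_fun setT (@training_part k n).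
Proof. exact: measurable_tuple_select. Qed.

Lemma measurable_held_out k n (E : set (n.-tuple T * T)) : measurable E ->
  measurable [set t : (k + n).-tuple T |
    forall j, E (training_part t, tnth t (lshift n j))].
Proof.
move=> mE; rewrite (_ : mkset _ = \bigcap_(j in [set: 'I_k])
    ((fun t => (training_part t, tnth t (lshift n j))) @^-1` E)).
  apply: fin_bigcap_measurable => // j _; rewrite -[X in measurable X]setTI.
  exact: (measurable_fun_pair (@measurable_training_part k n)
    (measurable_tnth _)).
by apply/seteqP; split => t Et j; [move=> _; exact: Et|exact: (Et j I)].
Qed.

(** Given the training set, the [k] test points are independent: when the
    conditional probability of [E] is at least [c], they all fall in [E] with
    conditional probability at least [c ^+ k]. *)
Lemma iid_held_out_power P k n (E : set (n.-tuple T * T)) (c : R) :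
  measurable E -> 0 <= c ->
  ((c ^+ k)%:E * iid P n [set D | c%:E <= P (xsection E D)]
   <= iid P (k + n)
        [set t | forall j, E (training_part t, tnth t (lshift n j))])%E.
Proof.
move=> mE c0; set S := [set D | _].
have mS : measurable S.
  rewrite -[S]setTI; apply: emeasurable_fun_c_infty => //.
  exact: measurable_fun_xsection.
pose Q k := [set t : (k + n).-tuple T |
  S (training_part t) /\ forall j, E (training_part t, tnth t (lshift n j))].
have mtrain k' := @measurable_training_part k' n.
have mheld k' := @measurable_held_out k' n E mE.
have mQ k' : measurable (Q k').
  apply: measurableI => //.
  by rewrite -[X in measurable X]setTI; exact: mtrain.
suff main : ((c ^+ k)%:E * iid P n S <= iid P (k + n) (Q k))%E.
  apply: (le_trans main); apply: le_measure; rewrite ?inE.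
  - exact: mQ.
  - exact: mheld.
  - by move=> t [].
elim: k => [|k IHk].
  rewrite expr0 mul1e.
  rewrite le_eqVlt; apply/orP; left; apply/eqP; congr (iid P n _).
  have trainE (t : (0 + n).-tuple T) : training_part t = t.
    by apply: eq_from_tnth => i; rewrite tnth_mktuple; congr tnth; exact: val_inj.
  apply/seteqP; split => t; rewrite /Q /= trainE; last by case.
  by move=> St; split => // -[].
pose A := [set z : T * (k + n).-tuple T | Q k z.2 /\ E (training_part z.2, z.1)].
(* The first draw is the new test point. *)
have QA : iid P (k.+1 + n) (Q k.+1) = (P \x iid P (k + n))%E A.
  rewrite /= /distribution /pushforward; congr (_ _).
  have trainE z t : training_part (k := k.+1) (tuple_cons (z, t)) =
      training_part t.
    apply: eq_from_tnth => i; rewrite !tnth_mktuple.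
    rewrite -(tnthS z t); congr tnth; exact: val_inj.
  have ordE (i : 'I_k) : lshift n (lift ord0 i) = lift ord0 (lshift n i).
    exact: val_inj.
  have ord0E : lshift n (ord0 : 'I_k.+1) = ord0 by exact: val_inj.
  apply/seteqP; split => -[z t] /=; rewrite /Q /A /= trainE.
    move=> [St Et]; split; last first.
      by have := Et ord0; rewrite ord0E /tuple_cons tnth0.
    by split => // j; have := Et (lift ord0 j); rewrite ordE /tuple_cons tnthS.
  move=> [[St Et] Ez]; split => // j.
  case: (unliftP ord0 j) => [i|] ->; first by rewrite ordE tnthS.
  by rewrite ord0E tnth0.
have mA : measurable A.
  have mpair : measurable_fun setT
      (fun z : T * (k + n).-tuple T => (training_part z.2, z.1)).
    apply: measurable_fun_pair => //.
    exact: (measurableT_comp (mtrain k) measurable_snd).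
  apply: measurableI; rewrite -[X in measurable X]setTI; last exact: mpair.
  exact: (@measurable_snd _ _ _ _ measurableT _ (mQ k)).
rewrite QA.
have -> : (P \x iid P (k + n))%E A =
    (\int[P \x iid P (k + n)]_z (\1_A z)%:E)%E by rewrite integral_indic// setIT.
rewrite fubini_tonelli2//; last first.
  exact/measurable_EFinP/measurable_indic.
rewrite exprS EFinM -muleA.
apply: (@le_trans _ _ (c%:E * iid P (k + n) (Q k))%E).
  by apply: lee_wpmul2l; rewrite ?lee_fin.
have mQk := mQ k.
have mind : measurable_fun setT
    (fun t : (k + n).-tuple T => (\1_(Q k) t)%:E : \bar R).
  exact/measurable_EFinP/measurable_indic.
rewrite -[Q k]setIT -(integral_indic (iid P (k + n)))//.
rewrite -ge0_integralZl_EFin//.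
apply: ge0_le_integral => //=.
- by move=> t _; rewrite -EFinM lee_fin mulr_ge0.
- exact: measurable_funeM.
- apply: measurable_fun_fubini_tonelli_G => //.
  exact/measurable_EFinP/measurable_indic.
- move=> t _; rewrite /fubini_G indicE.
  have [/set_mem Qt|_] := boolP (t \in Q k); last first.
    by rewrite mule0; apply: integral_ge0 => z _; rewrite lee_fin.
  rewrite mule1; apply: (@le_trans _ _ (P (xsection E (training_part t)))).
    by case: Qt.
  rewrite le_eqVlt -[X in P X]setIT -(integral_indic P) => [|//|]; last first.
    exact: measurable_xsection.
  apply/orP; left; apply/eqP; apply: eq_integral => z _; rewrite !indicE.
  congr ((nat_of_bool _)%:R%:E); apply/idP/idP => [/set_mem/xsectionP Ez|/set_mem[_ Ez]].
    by apply/mem_set; split.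
  exact/mem_set/xsectionP.
Qed.

End held_out.

Section miscoverage.
Context {d} {X : measurableType d} {R : realType}.
Implicit Types (A : algorithm X R) (P : probability (X * R)%type R).

(** Strict comparison with a quantile is a condition on a count; this is what
    makes coverage measurable and ties it to ranks. *)
Lemma not_le_quantile n (v : 'I_n -> R) (tau a : R) :
  (~ (a%:E <= quantile v tau)%E) <->
  (tau <= 1 /\ tau * n%:R <= #|[set i | v i < a]%SET|%:R).
Proof.
rewrite /quantile; case: ltP => tau1; first by rewrite leey; split => // -[].
split=> [/negP|[_ cnt]].
  rewrite -ltNge => /ereal_inf_lt [_ [t cnt <-]]; rewrite lte_fin => ta.
  split=> //; apply: (le_trans cnt); rewrite ler_nat.
  apply: subset_leq_card; apply/fintype.subsetP => i; rewrite !inE => /le_lt_trans.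
  exact.
(* [t] is the largest value below [a], or [a - 1] if there is none. *)
pose t := \big[Num.max/(a - 1)]_(i | v i < a) v i.
have ta : t < a.
  rewrite /t; elim/big_ind: _ => // [|x y xa ya]; first by rewrite ltrBlDr ltrDl.
  by rewrite gt_max xa ya.
apply/negP; rewrite -ltNge; apply: (@le_lt_trans _ _ t%:E); last by rewrite lte_fin.
apply: ereal_inf_lbound; exists t => //=; apply: (le_trans cnt).
rewrite ler_nat; apply: subset_leq_card; apply/fintype.subsetP => i; rewrite !inE => va.
by apply: le_bigmax_cond.
Qed.

Lemma not_covered A alpha gamma n (D : n.-tuple (X * R)) (x : X) (y : R) :
  let tau := (1 - alpha) * (1 + n%:R^-1) in
  (~ inflated_jackknife_plus alpha gamma A D x y) <->
  (tau <= 1 /\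
   (tau * n%:R <=
      #|[set i | - loo_fit A D i x + loo_residual A D i < - y - gamma]%SET|%:R
    \/ tau * n%:R <=
      #|[set i | loo_fit A D i x + loo_residual A D i < y - gamma]%SET|%:R)).
Proof.
move=> tau; rewrite /inflated_jackknife_plus /= -/tau.
set lo := quantile _ _; set hi := quantile _ _.
have -> : ((- lo - gamma%:E <= y%:E)%E = ((- y - gamma)%:E <= lo)%E).
  rewrite leeBlDr// -EFinD leeNl -EFinN opprD//.
have -> : ((y%:E <= hi + gamma%:E)%E = ((y - gamma)%:E <= hi)%E).
  by rewrite EFinB leeBlDr.
have := not_le_quantile (fun i => - loo_fit A D i x + loo_residual A D i) tau
  (- y - gamma).
have := not_le_quantile (fun i => loo_fit A D i x + loo_residual A D i) tau
  (y - gamma).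
rewrite -/lo -/hi.
move=> hiP loP; split.
  move=> /negP; rewrite negb_and => /orP[/negP/loP[? ?]|/negP/hiP[? ?]].
    by split => //; left.
  by split => //; right.
by move=> [tau1 [cnt|cnt]] /andP[lo1 hi1]; [apply/loP: lo1|apply/hiP: hi1].
Qed.

Lemma measurable_loo_fit A : measurable_algorithm A ->
  forall n d' (Om : measurableType d') (i : 'I_n)
    (u : Om -> n.-tuple (X * R)) (v : Om -> X),
  measurable_fun setT u -> measurable_fun setT v ->
  measurable_fun setT (fun w => loo_fit A (u w) i (v w)).
Proof.
move=> mA n d' Om i u v.
exact: (measurable_fit_on mA [seq j <- enum 'I_n | j != i]).
Qed.

Lemma measurable_loo_residual A : measurable_algorithm A ->
  forall n (i : 'I_n),
  measurable_fun setT (fun D : n.-tuple (X * R) => loo_residual A D i).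
Proof.
move=> mA n i; apply: measurableT_comp => //; apply: measurable_funB.
  exact: (measurableT_comp measurable_snd (measurable_tnth i)).
by apply: measurable_loo_fit => //; exact: measurable_testpoint.
Qed.

Definition miscovered_set A alpha gamma n :
    set (n.-tuple (X * R) * (X * R)) :=
  [set p | ~ inflated_jackknife_plus alpha gamma A p.1 p.2.1 p.2.2].

Lemma measurable_miscovered_set A alpha gamma n : measurable_algorithm A ->
  measurable (@miscovered_set A alpha gamma n).
Proof.
move=> mA; pose tau : R := (1 - alpha) * (1 + n%:R^-1).
pose lo (i : 'I_n) (p : n.-tuple (X * R) * (X * R)) : bool :=
  - loo_fit A p.1 i p.2.1 + loo_residual A p.1 i < - p.2.2 - gamma.
pose hi (i : 'I_n) (p : n.-tuple (X * R) * (X * R)) : bool :=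
  loo_fit A p.1 i p.2.1 + loo_residual A p.1 i < p.2.2 - gamma.
pose cnt (S : {set 'I_n}) : bool := (tau <= 1) && (tau * n%:R <= #|S|%:R).
rewrite (_ : @miscovered_set _ _ _ _ = [set p | cnt [set i | lo i p]%SET] `|`
    [set p | cnt [set i | hi i p]%SET]); last first.
  apply/seteqP; split => p.
    move=> /not_covered; rewrite -/tau /cnt => -[/= -> [c|c]].
      by left; exact: c.
    by right; exact: c.
  move=> /= c; apply/not_covered; rewrite -/tau; case: c => /andP[tau1 c].
    by split => //; left.
  by split => //; right.
have mfit i : measurable_fun setT
    (fun p : n.-tuple (X * R) * (X * R) => loo_fit A p.1 i p.2.1).
  apply: measurable_loo_fit => //.
  exact: (measurableT_comp measurable_fst measurable_snd).
have mres i : measurable_fun setT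
    (fun p : n.-tuple (X * R) * (X * R) => loo_residual A p.1 i).
  exact: (measurableT_comp (measurable_loo_residual mA i) measurable_fst).
have my : measurable_fun setT (fun p : n.-tuple (X * R) * (X * R) => p.2.2).
  exact: (measurableT_comp measurable_snd measurable_snd).
apply: measurableU; apply: measurable_finite_pred => i;
  rewrite -[X in measurable X]setTI.
- apply: measurable_fun_ltr => //.
    by apply: measurable_funD => //; exact: measurableT_comp.
  by apply: measurable_funB => //; exact: measurableT_comp.
- apply: measurable_fun_ltr => //; first exact: measurable_funD.
  exact: measurable_funB.
Qed.

(** Stating miscoverage as the measure of a section gives its measurability in the
    data set from Fubini's theorem. *)
Lemma miscoverageE P A alpha gamma n (D : n.-tuple (X * R)) :
  miscoverage P (inflated_jackknife_plus alpha gamma A (n := n)) D =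
  P (xsection (@miscovered_set A alpha gamma n) D).
Proof.
by rewrite /miscoverage; congr (P _); apply/seteqP; split => z;
  rewrite /xsection /= inE.
Qed.

End miscoverage.

(** * The finite-sample tail bound *)

Section tail_bound.
Context {d} {X : measurableType d} {R : realType}.
Implicit Types (A : algorithm X R) (P : probability (X * R)%type R).

Definition other_train k n (i : 'I_n) : seq 'I_(k + n) :=
  [seq rshift k l | l <- enum 'I_n & l != i].

Lemma size_other_train k n (i : 'I_n) : size (other_train k i) = n.-1.
Proof.
rewrite size_map size_filter -[in RHS](size_enum_ord n).
rewrite -(count_predC (pred1 i)) count_uniq_mem ?enum_uniq// mem_enum.
by rewrite add1n.
Qed.

Lemma uniq_other_train k n (i : 'I_n) : uniq (other_train k i).
Proof.
rewrite map_inj_uniq; last exact: rshift_inj.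
by rewrite filter_uniq ?enum_uniq.
Qed.

Lemma lshift_notin_other_train k n (i : 'I_n) (j : 'I_k) :
  lshift n j \notin other_train k i.
Proof.
apply/mapP => -[l _ /(congr1 val)/= jl].
by have := ltn_ord j; rewrite jl ltnNge leq_addr.
Qed.

Lemma rshift_notin_other_train k n (i : 'I_n) :
  rshift k i \notin other_train k i.
Proof.
rewrite mem_map; last exact: rshift_inj.
by rewrite mem_filter eqxx.
Qed.

Lemma loo_fit_training_part A k n (t : (k + n).-tuple (X * R)) (i : 'I_n) :
  loo_fit A (training_part t) i = fit_on A t (other_train k i).
Proof.
rewrite /loo_fit /fit_on /other_train -map_comp; congr A.
by apply: eq_map => l; rewrite /= tnth_mktuple.
Qed.

(** The distance at point [j] between the jackknife+ model, fitted to the training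
    points other than [i], and the exchangeable model, fitted to all [k + n - 1]
    points other than [j]. *)
Definition drift A k n (i : 'I_n) (j : 'I_(k + n)) (t : (k + n).-tuple (X * R))
    : R :=
  `|fit_on A t (other_train k i) (tnth t j).1 - loo_fit A t j (tnth t j).1|.

Lemma drift_ge0 A k n (i : 'I_n) (j : 'I_(k + n)) t : 0 <= drift A i j t.
Proof. exact: normr_ge0. Qed.
Hint Resolve drift_ge0 : core.

(** Both fits that enter the comparison of test point [j] with training point [i]
    have to move little: the one at [j] and the one at [i].  Summing over all test
    points makes one application of Markov's inequality serve them all. *)
Definition total_drift A k n (t : (k + n).-tuple (X * R)) : R :=
  \sum_(j < k) \sum_(i < n)
    (drift A i (lshift n j) t + drift A i (rshift k i) t).

Lemma measurable_drift A k n (i : 'I_n) (j : 'I_(k + n)) :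
  measurable_algorithm A -> measurable_fun setT (drift A i j).
Proof.
move=> mA; apply: measurableT_comp => //; apply: measurable_funB.
  by apply: measurable_fit_on => //; exact: measurable_testpoint.
by apply: measurable_loo_fit => //; exact: measurable_testpoint.
Qed.

(** The two models differ by the addition of [k] training points, starting from
    [n.-1]. *)
Lemma integral_drift_le A P k n (i : 'I_n) (j : 'I_(k + n)) (b : R) :
  symmetric_algorithm A -> measurable_algorithm A -> j \notin other_train k i ->
  (beta_out_star A P n.-1 <= b%:E)%E ->
  (\int[iid P (k + n)]_t (drift A i j t)%:E <= (k%:R * b)%:E)%E.
Proof.
move=> symA mA ji betab.
have n0 : (0 < n)%N by case: n i {j ji betab} => [[]|].
have kE : (k + n - (size (other_train k i)).+1)%N = k.
  by rewrite size_other_train prednK// addnK.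
rewrite -[in leRHS]kE; apply: integral_loo_fit_le => //.
  by rewrite cons_uniq ji uniq_other_train.
move=> m; rewrite size_other_train => nm; apply: le_trans betab.
by apply: ereal_sup_ubound; exists m.
Qed.

Lemma integral_total_drift_le A P k n (b : R) :
  symmetric_algorithm A -> measurable_algorithm A ->
  (beta_out_star A P n.-1 <= b%:E)%E ->
  (\int[iid P (k + n)]_t (@total_drift A k n t)%:E
   <= ((k * n * k.*2)%:R * b)%:E)%E.
Proof.
move=> symA mA betab.
have mdrift i j : measurable_fun setT (fun t => (@drift A k n i j t)%:E : \bar R).
  by apply/measurable_EFinP; exact: measurable_drift.
under eq_integral do rewrite -sumEFin.
rewrite ge0_integral_sum//=; last 2 first.
- move=> j; apply/measurable_EFinP; apply: measurable_sum => i.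
  by apply: measurable_funD; exact: measurable_drift.
- by move=> j t _; rewrite lee_fin; apply: sumr_ge0 => i _; exact: addr_ge0.
have -> : ((k * n * k.*2)%:R * b)%:E = (\sum_(j < k) \sum_(i < n)
    (k%:R * b + k%:R * b)%:E)%E.
  rewrite !sumEFin; congr (_%:E).
  by rewrite !sumr_const !card_ord -mulrnA -[RHS]mulr_natl -muln2 !natrM; ring.
apply: lee_sum => j _; under eq_integral do rewrite -sumEFin.
rewrite ge0_integral_sum//=; last 2 first.
- move=> i; apply/measurable_EFinP.
  by apply: measurable_funD; exact: measurable_drift.
- by move=> i t _; rewrite lee_fin; exact: addr_ge0.
apply: lee_sum => i _; under eq_integral do rewrite EFinD.
rewrite ge0_integralD//=; last 2 first.
- by move=> t _; rewrite lee_fin.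
- by move=> t _; rewrite lee_fin.
rewrite EFinD; apply: leeD; apply: integral_drift_le => //.
  exact: lshift_notin_other_train.
exact: rshift_notin_other_train.
Qed.

(** A miscovered test point has, by more than [gamma], a larger error than the
    residual of at least [(1 - alpha) * n] training points.  The slack [gamma]
    absorbs the passage to the exchangeable residuals, except for the training
    points whose two drifts sum to at least [gamma]; there are at most
    [delta * n] of those. *)
Lemma miscovered_top A alpha gamma delta k n (t : (k + n).-tuple (X * R))
    (j : 'I_k) :
  (0 < n)%N -> alpha <= 1 -> 0 < gamma ->
  miscovered_set A alpha gamma (training_part t, tnth t (lshift n j)) ->
  total_drift A t < delta * n%:R * gamma ->
  lshift n j \in top_set ((1 - alpha - delta) * n%:R) (loo_residual A t).
Proof.
move=> n0 alpha1 gamma0.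
set jj := lshift n j; set D := training_part t.
move=> /not_covered[_ misc] small.
(* Training points that vote for miscoverage, and those that drift too much. *)
pose exceed := [set i | loo_residual A D i + gamma <
   `|(tnth t jj).2 - loo_fit A D i (tnth t jj).1|]%SET.
have exceed_ge : (1 - alpha) * n%:R <= #|exceed|%:R.
  have tau_ge : (1 - alpha) * n%:R <= (1 - alpha) * (1 + n%:R^-1) * n%:R.
    rewrite ler_wpM2r// ler_peMr ?subr_ge0// lerDl invr_ge0//.
  apply: (le_trans tau_ge); case: misc => /le_trans; apply;
    rewrite ler_nat; apply: subset_leq_card; apply/fintype.subsetP => i;
    rewrite !inE /= => lt_i; rewrite ltr_normr; apply/orP; [right|left]; lra.
pose bad := [set i | gamma <= drift A i jj t + drift A i (rshift k i) t]%SET.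
have bad_le : #|bad|%:R <= delta * n%:R.
  rewrite -(ler_pM2r gamma0); apply: le_trans (ltW small).
  apply: (@le_trans _ _ (\sum_(i < n)
      (drift A i jj t + drift A i (rshift k i) t))); last first.
    rewrite /total_drift (bigD1 j)//= lerDl; apply: sumr_ge0 => l _.
    by apply: sumr_ge0 => i _; exact: addr_ge0.
  rewrite (bigID (mem bad))/= -[leLHS]addr0; apply: lerD.
    rewrite mulr_natl -sumr_const; apply: ler_sum => i.
    by rewrite inE.
  by apply: sumr_ge0 => i _; exact: addr_ge0.
(* For the remaining points the drifts sum to less than the slack. *)
have good_sub : ([set rshift k i | i in exceed :\: bad] \subset
    [set i | loo_residual A t i < loo_residual A t jj])%SET.
  apply/fintype.subsetP => _ /imsetP[i + ->]; rewrite !inE -ltNge.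
  rewrite /drift /loo_residual loo_fit_training_part tnth_mktuple.
  move=> /andP[lt_gamma gt_gamma].
  set y := (tnth t jj).2 in gt_gamma *.
  set y' := (tnth t (rshift k i)).2 in gt_gamma *.
  set u := fit_on _ _ _ _ in lt_gamma gt_gamma.
  set v := loo_fit _ _ jj _ in lt_gamma *.
  set u' := fit_on _ _ _ _ in lt_gamma gt_gamma.
  set v' := loo_fit _ _ _ _ in lt_gamma *.
  have := ler_distD u y v; have := ler_distD v y u.
  have := ler_distD u' y' v'.
  rewrite (distrC v u); lra.
rewrite inE; apply: (@le_trans _ _ #|exceed :\: bad|%:R).
  rewrite mulrBl lerBlDr; apply: (le_trans exceed_ge).
  apply: le_trans (_ : (#|exceed :\: bad| + #|bad|)%:R <= _); last first.
    by rewrite natrD lerD2l.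
  rewrite ler_nat -(cardsID bad exceed) addnC leq_add2l.
  by rewrite subset_leq_card// subsetIr.
rewrite ler_nat -(card_imset _ (@rshift_inj k n)).
exact: subset_leq_card.
Qed.

Lemma expn_le_ffact n k : (n ^ k <= (k + n) ^_ k)%N.
Proof.
rewrite ffact_prod -[X in (n ^ X)%N](card_ord k) -prod_nat_const.
apply: leq_prod => i _; have := ltn_ord i; lia.
Qed.

Lemma measurable_all_top A k n (c : R) : measurable_algorithm A ->
  measurable [set t : (k + n).-tuple (X * R) |
    forall j : 'I_k, lshift n j \in top_set c (loo_residual A t)].
Proof.
move=> mA; pose Q (S : {set 'I_(k + n)}) := [forall j : 'I_k, lshift n j \in S].
rewrite (_ : mkset _ = [set t | Q (top_set c (loo_residual A t))]).
  exact: (measurable_top_set c Q (measurable_loo_residual mA (n := k + n))).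
by apply/seteqP; split => t /forallP.
Qed.

Lemma iid_all_top_le A P (alpha delta : R) k n :
  symmetric_algorithm A -> measurable_algorithm A ->
  (0 < n)%N -> 0 <= alpha -> 0 <= delta ->
  (iid P (k + n) [set t | forall j : 'I_k, lshift n j \in
      top_set ((1 - alpha - delta) * n%:R) (loo_residual A t)]
   <= ((alpha + delta + k%:R / n%:R) ^+ k)%:E)%E.
Proof.
move=> symA mA n0 alpha0 delta0.
have n0' : 0 < n%:R :> R by rewrite ltr0n.
set c := (1 - alpha - delta) * n%:R.
have cN : c <= (k + n)%:R.
  rewrite natrD -[leLHS]add0r; apply: lerD => //.
  by rewrite /c -[leRHS]mul1r ler_pM2r//; lra.
have eqr (s : 'S_(k + n)) t i :
    loo_residual A (tuple_select s t) i = loo_residual A t (s i).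
  rewrite /loo_residual tnth_mktuple; congr (`|_ - _|).
  apply: symmetric_algorithm_perm => //.
  rewrite (eq_map (g := tnth t \o s)); last by move=> l; rewrite tnth_mktuple.
  rewrite map_comp; apply: perm_map; apply: uniq_perm.
  - rewrite map_inj_uniq; last exact: perm_inj.
    by rewrite filter_uniq ?enum_uniq.
  - by rewrite filter_uniq ?enum_uniq.
  - move=> l; rewrite mem_filter mem_enum andbT -[l](permKV s) mem_map;
      last exact: perm_inj.
    by rewrite mem_filter mem_enum andbT (inj_eq perm_inj).
have := exchangeable_top_set P (@lshift_inj k n) cN
  (measurable_loo_residual mA (n := k + n)) eqr.
set E := [set t | _].
have mE : measurable E by exact: measurable_all_top.
rewrite -[iid P (k + n) E]fineK ?fin_num_measure// -EFinM !lee_fin => le_c.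
have p0 : 0 <= fine (iid P (k + n) E) by rewrite fine_ge0.
rewrite -(ler_pM2l (exprn_gt0 k n0')) -exprMn.
apply: (@le_trans _ _ (((k + n) ^_ k)%:R * fine (iid P (k + n) E))).
  by rewrite ler_wpM2r// -natrX ler_nat expn_le_ffact.
apply: (le_trans le_c); rewrite le_eqVlt; apply/orP; left; apply/eqP.
congr (_ ^+ k); rewrite /c natrD; field.
by rewrite gt_eqF.
Qed.

(** Either all test points are top points, or the total drift is at
    least [delta * n * gamma], in which case Markov's inequality applies. *)
Lemma jackknife_tail_bound A P (alpha gamma delta b c : R) k n :
  symmetric_algorithm A -> measurable_algorithm A ->
  (0 < n)%N -> 0 <= alpha -> alpha <= 1 -> 0 < gamma -> 0 < delta -> 0 <= c ->
  (beta_out_star A P n.-1 <= b%:E)%E ->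
  ((c ^+ k)%:E * iid P n [set D | c%:E <=
      miscoverage P (inflated_jackknife_plus alpha gamma A (n := n)) D]
   <= ((alpha + delta + k%:R / n%:R) ^+ k
       + (k * k.*2)%:R * b / (delta * gamma))%:E)%E.
Proof.
move=> symA mA n0 alpha0 alpha1 gamma0 delta0 c0 betab.
under eq_set do rewrite miscoverageE.
apply: le_trans (iid_held_out_power P k
  (@measurable_miscovered_set _ _ _ A alpha gamma n mA) c0) _.
set level : R := delta * n%:R * gamma.
have level0 : 0 < level by rewrite !mulr_gt0// ltr0n.
have mdrift : measurable_fun setT (@total_drift A k n).
  apply: measurable_sum => j; apply: measurable_sum => i.
  by apply: measurable_funD; exact: measurable_drift.
pose top := [set t : (k + n).-tuple (X * R) | forall j : 'I_k, lshift n j \in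
      top_set ((1 - alpha - delta) * n%:R) (loo_residual A t)].
pose unstable := [set t : (k + n).-tuple (X * R) | level <= total_drift A t].
have mtop : measurable top by exact: measurable_all_top.
have munstable : measurable unstable.
  rewrite -[unstable]setTI; exact: measurable_fun_ler.
apply: (@le_trans _ _ (iid P (k + n) (top `|` unstable))).
  apply: le_measure; rewrite ?inE.
  - exact: (@measurable_held_out _ _ k n _
      (@measurable_miscovered_set _ _ _ A alpha gamma n mA)).
  - exact: measurableU.
  - move=> t misc; have [|small] := leP level (total_drift A t); first by right.
    by left => j; apply: miscovered_top small; rewrite //; exact: misc.
apply: (le_trans (measureU2 (iid P (k + n)) mtop munstable)).
rewrite EFinD; apply: leeD.
  by apply: iid_all_top_le => //; exact: ltW.
have mEdrift : measurable_fun setT (fun t => (@total_drift A k n t)%:E : \bar R).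
  exact/measurable_EFinP.
have drift0 t : 0 <= @total_drift A k n t.
  by apply: sumr_ge0 => j _; apply: sumr_ge0 => i _; exact: addr_ge0.
have markov : (level%:E * iid P (k + n) unstable <=
    ((k * n * k.*2)%:R * b)%:E)%E.
  apply: (le_trans _ (integral_total_drift_le k symA mA betab)).
  have := le_integral_abse (iid P (k + n)) measurableT mEdrift level0.
  rewrite setTI; under eq_integral do rewrite gee0_abs ?lee_fin//.
  by under eq_set do rewrite gee0_abs ?lee_fin//.
move: markov; rewrite -[iid P (k + n) unstable]fineK ?fin_num_measure//.
rewrite -EFinM lee_fin => markov.
rewrite -[leLHS]fineK ?fin_num_measure// lee_fin.
rewrite -(ler_pM2l level0); apply: (le_trans markov).
rewrite le_eqVlt; apply/orP; left; apply/eqP.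
rewrite /level !natrM; field.
by rewrite !gt_eqF// ltr0n.
Qed.

End tail_bound.

(** * Bounded conditional densities *)

Section density.
Context {d} {X : measurableType d} {R : realType}.
Implicit Types (P : probability (X * R)%type R) (f : X -> R -> R).

Lemma section_integralE (g : X * R -> \bar R) (A : set (X * R)) (x : X) :
  fubini_F (@lebesgue_measure R) (g \_ A) x =
  (\int[lebesgue_measure]_(y in xsection A x) g (x, y))%E.
Proof.
rewrite /fubini_F [RHS]integral_mkcond; apply: eq_integral => y _.
rewrite /patch; congr (if _ then _ else _).
by apply/idP/idP => /set_mem zy; apply/mem_set/xsectionP.
Qed.

(** Both sides are measures in [E], which agree on rectangles. *)
Lemma conditional_densityE P f (E : set (X * R)) :
  conditional_density P f -> measurable E ->
  P E = (\int[P]_z \int[lebesgue_measure]_(y in xsection E z.1)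
           (f z.1 y)%:E)%E.
Proof.
move=> [f0 mf fP] mE.
pose PX : probability X R := distribution P
  (HB.pack_for {mfun (X * R)%type >-> X} fst
    (isMeasurableFun.Build _ _ _ _ fst measurable_fst)).
pose mu := (PX \x (@lebesgue_measure R))%E.
pose g (z : X * R) : \bar R := (f z.1 z.2)%:E.
have mg : measurable_fun setT g by exact/measurable_EFinP.
have g0 z : (0 <= g z)%E by rewrite lee_fin.
(* The measure with density [g] with respect to the product of the law of [X]
   and Lebesgue measure. *)
pose nu0 (A : set (X * R)) : \bar R := (\int[mu]_(z in A) g z)%E.
have nu00 : nu0 set0 = 0 by exact: integral_set0.
have nu0_ge0 A : (0 <= nu0 A)%E by apply: integral_ge0.
have nu0_additive : semi_sigma_additive nu0.
  exact: (@semi_sigma_additive_nng_induced _ _ _ mu g mg g0).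
pose nu : {measure set (X * R) -> \bar R} := HB.pack nu0
  (isMeasure.Build _ _ _ nu0 nu00 nu0_ge0 nu0_additive).
have nuE (A : set (X * R)) : measurable A -> nu A =
    (\int[P]_z \int[lebesgue_measure]_(y in xsection A z.1) (f z.1 y)%:E)%E.
  move=> mA.
  rewrite -[LHS]/(\int[mu]_(z in A) g z)%E integral_mkcond.
  have mgA : measurable_fun setT (g \_ A).
    by apply/(measurable_restrictT _ mA); exact: measurable_funTS.
  have gA0 z : (0 <= (g \_ A) z)%E by rewrite /patch; case: ifP.
  rewrite fubini_tonelli1//.
  rewrite ge0_integral_pushforward//; last 2 first.
  - exact: measurable_fun_fubini_tonelli_F.
  - by move=> x _; apply: integral_ge0.
  rewrite preimage_setT; apply: eq_integral => z _ /=.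
  exact: section_integralE.
rewrite -nuE//.
apply: (measure_unique _ (fun=> setT) (measurable_prod_measurableType _ _)) => //.
- move=> _ _ [S1 mS1 [B1 mB1 <-]] [S2 mS2 [B2 mB2 <-]].
  exists (S1 `&` S2); first exact: measurableI.
  by exists (B1 `&` B2); [exact: measurableI|rewrite setXI].
- by move=> _; exists setT => //; exists setT => //; rewrite setXTT.
- by rewrite bigcup_const.
- move=> _ [S mS [B mB <-]]; rewrite [LHS]fP// [RHS]nuE; last exact: measurableX.
  rewrite integral_mkcond; apply: eq_integral => z _; rewrite /patch.
  case: ifPn => [/set_mem[/= Sz _]|].
    by rewrite in_xsectionX// inE.
  rewrite notin_setE => Sz; rewrite notin_xsectionX ?integral_set0//.
  by rewrite notin_setE => Sz1; apply: Sz.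
- by move=> _; rewrite [X in (X < _)%E](probability_setT P) ltry.
Qed.

(** At each [x] the density is at most its supremum, and the section of [E] has
    length at most [w]. *)
Lemma density_slab_le P f (E : set (X * R)) (w : R) :
  conditional_density P f -> measurable_fun setT (sup_density f) ->
  measurable E -> 0 <= w ->
  (forall x, (@lebesgue_measure R (xsection E x) <= w%:E)%E) ->
  (P E <= w%:E * \int[P]_z sup_density f z.1)%E.
Proof.
move=> df msup mE w0 Ew; rewrite (conditional_densityE df mE).
have [f0 mf _] := df.
have sup_ge x y : ((f x y)%:E <= sup_density f x)%E.
  by apply: ereal_sup_ubound; exists y.
have sup_ge0 x : (0 <= sup_density f x)%E.
  by apply: le_trans (sup_ge x 0); rewrite lee_fin.
have msup1 : measurable_fun setT (fun z : X * R => sup_density f z.1).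
  exact: (measurableT_comp msup measurable_fst).
rewrite -ge0_integralZl_EFin//.
have mfx x : measurable_fun setT (fun y => (f x y)%:E : \bar R).
  apply/measurable_EFinP.
  exact: (measurableT_comp mf (measurable_pair1 x)).
apply: ge0_le_integral => //=.
- by move=> z _; apply: integral_ge0 => y _; rewrite lee_fin.
- pose g (z : X * R) : \bar R := (f z.1 z.2)%:E.
  have mgE : measurable_fun setT (g \_ E).
    apply/(measurable_restrictT _ mE); apply: measurable_funTS.
    exact/measurable_EFinP.
  have gE0 z : (0 <= (g \_ E) z)%E.
    by rewrite /patch; case: ifP => // _; rewrite lee_fin.
  under eq_fun do rewrite -(section_integralE g).
  apply: (@measurableT_comp _ _ _ _ _ _
    (fubini_F lebesgue_measure (g \_ E)) _ fst) => //.
  exact: measurable_fun_fubini_tonelli_F.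
- exact: measurable_funeM.
- move=> [x y] _ /=.
  have mEx : measurable (xsection E x) by exact: measurable_xsection.
  apply: (@le_trans _ _ (\int[lebesgue_measure]_(y in xsection E x)
      cst (sup_density f x) y)%E).
    apply: ge0_le_integral => //=; first by move=> ? _; rewrite lee_fin.
    exact: (measurable_funTS (mfx x)).
  rewrite integral_cst// muleC; apply: lee_wpmul2r; first exact: sup_ge0.
  exact: Ew.
Qed.
(** The part that inflation adds above the interval, for any upper endpoint: when
    the endpoint is infinite the slab is empty.  Exhibiting it as an interval
    gives its measurability and its length. *)
Lemma slab_above (e : \bar R) (w : R) : 0 <= w -> exists i : interval R,
  [set y : R | (e < y%:E)%E /\ (y%:E <= e + w%:E)%E] = [set` i] /\
  (@lebesgue_measure R [set` i] <= w%:E)%E.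
Proof.
move=> w0; case: e => [r| |].
- exists `]r, (r + w)]; split.
    apply/seteqP; split => y /=; rewrite in_itv/= -EFinD !lte_fin lee_fin.
      by move=> [-> ->].
    by move=> /andP[].
  rewrite lebesgue_measure_itv/= lte_fin; case: ifPn => _.
    by rewrite -EFinD addrAC subrr add0r.
  by rewrite lee_fin.
- exists `]0, 0[; split.
    apply/seteqP; split => y /=; first by case; rewrite ltNge leey.
    by rewrite in_itv/= => /andP[/lt_trans/[apply]]; rewrite ltxx.
  by rewrite lebesgue_measure_itv/= ltxx lee_fin.
- exists `]0, 0[; split.
    apply/seteqP; split => y /=; first by case.
    by rewrite in_itv/= => /andP[/lt_trans/[apply]]; rewrite ltxx.
  by rewrite lebesgue_measure_itv/= ltxx lee_fin.
Qed.

Lemma slab_below (e : \bar R) (w : R) : 0 <= w -> exists i : interval R,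
  [set y : R | (y%:E < e)%E /\ (e - w%:E <= y%:E)%E] = [set` i] /\
  (@lebesgue_measure R [set` i] <= w%:E)%E.
Proof.
move=> w0; case: e => [r| |].
- exists `[(r - w), r[; split.
    apply/seteqP; split => y /=; rewrite in_itv/= -EFinB !lte_fin lee_fin.
      by move=> [-> ->].
    by move=> /andP[].
  rewrite lebesgue_measure_itv/= lte_fin; case: ifPn => _.
    by rewrite -EFinB opprB addrC subrK.
  by rewrite lee_fin.
- exists `]0, 0[; split.
    apply/seteqP; split => y /=; first by case.
    by rewrite in_itv/= => /andP[/lt_trans/[apply]]; rewrite ltxx.
  by rewrite lebesgue_measure_itv/= ltxx lee_fin.
- exists `]0, 0[; split.
    apply/seteqP; split => y /=; first by case.
    by rewrite in_itv/= => /andP[/lt_trans/[apply]]; rewrite ltxx.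
  by rewrite lebesgue_measure_itv/= ltxx lee_fin.
Qed.

(** What the inflated interval covers and the original one misses lies in one slab
    of width [gamma] on each side. *)
Lemma miscoverage_deflate (A : algorithm X R) P (alpha gamma B : R) n
    (D : n.-tuple (X * R)) :
  measurable_algorithm A -> 0 <= gamma -> bounded_density B P ->
  (miscoverage P (jackknife_plus alpha A (n := n)) D
   <= miscoverage P (inflated_jackknife_plus alpha gamma A (n := n)) D
      + (2 * gamma * B)%:E)%E.
Proof.
move=> mA gamma0 [f [df msup fB]].
rewrite !miscoverageE.
set M0 := xsection _ D; set Mg := xsection _ D.
have mM0 : measurable M0.
  by apply: measurable_xsection; exact: measurable_miscovered_set.
have mMg : measurable Mg.
  by apply: measurable_xsection; exact: measurable_miscovered_set.
have mE : measurable (M0 `\` Mg) by exact: measurableD.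
apply: (@le_trans _ _ (P (Mg `|` (M0 `\` Mg)))).
  apply: le_measure; rewrite ?inE//; first exact: measurableU.
  by move=> z M0z; have [|] := pselect (Mg z); [left|right].
apply: (le_trans (measureU2 P mMg mE)); apply: leeD => //.
apply: (@le_trans _ _ ((2 * gamma)%:E * \int[P]_z sup_density f z.1)%E).
  apply: (density_slab_le df) => //; first by rewrite mulr_ge0.
  move=> x.
  set tau := (1 - alpha) * (1 + n%:R^-1).
  set lo := quantile (fun i => - loo_fit A D i x + loo_residual A D i) tau.
  set hi := quantile (fun i => loo_fit A D i x + loo_residual A D i) tau.
  have [i [ia ib]] := slab_above hi gamma0.
  have [j [ja jb]] := slab_below (- lo)%E gamma0.
  apply: (@le_trans _ _ (lebesgue_measure ([set` i] `|` [set` j]))).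
    apply: le_measure; rewrite ?inE; first exact: measurable_xsection.
      by apply: measurableU; exact: measurable_itv.
    rewrite -ia -ja => y /xsectionP; rewrite /setD /= => -[M0y Mgy].
    have {}M0y : ~ jackknife_plus alpha A D x y by move/xsectionP: M0y.
    have {Mgy} : inflated_jackknife_plus alpha gamma A D x y.
      by apply: contrapT => ncov; apply: Mgy; exact/xsectionP.
    rewrite /inflated_jackknife_plus /= -/tau -/lo -/hi => /andP[lo_y y_hi].
    have [hi_y|y_hi0] := ltP hi y%:E; first by left.
    right; split => //; rewrite ltNge; apply/negP => lo_y0; apply: M0y.
    rewrite /jackknife_plus /inflated_jackknife_plus /= -/tau -/lo -/hi.
    by rewrite sube0 adde0 lo_y0.
  apply: (le_trans (measureU2 _ _ _)); [exact: measurable_itv..|].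
  by rewrite mulr_natl mulr2n EFinD; exact: leeD.
rewrite [leRHS]EFinM; apply: lee_wpmul2l; first by rewrite lee_fin mulr_ge0.
exact: fB.
Qed.

End density.

(** * Rates that vanish uniformly over algorithms and distributions *)

Section vanishing.
Context {R : realType}.

Lemma cvg0_eventually_le (u : nat -> R) : u @ \oo --> 0 ->
  forall e, 0 < e -> exists N, forall n, (N <= n)%N -> u n <= e.
Proof.
move=> /cvgrPdist_le u0 e e0; have [N _ uN] := u0 e e0.
exists N => n /uN /=; rewrite sub0r normrN; exact: le_trans (ler_norm _).
Qed.

(** At index [n] use the finest accuracy [1/(m+1)] whose threshold [N m] has been
    passed.  Only positive [n] count in the first hypothesis because the suprema to
    which this applies may be over the empty set at [n = 0]. *)
Lemma diagonal_rate (p : R -> nat -> \bar R) :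
  (forall e n, (0 < n)%N -> (0 <= p e n)%E) ->
  (forall e eta, 0 < e -> 0 < eta ->
    exists N, forall n, (N <= n)%N -> (p e n <= eta%:E)%E) ->
  exists eps : nat -> R, eps @ \oo --> 0 /\
    (fun n => p (eps n) n) @ \oo --> 0%E.
Proof.
move=> p0 small.
pose r (m : nat) : R := m.+1%:R^-1.
have r0 m : 0 < r m by rewrite invr_gt0.
have [N NP] := choice (fun m => small (r m) (r m) (r0 m) (r0 m)).
pose early n := [pred m : 'I_n.+1 | (N m <= n)%N].
(* Restricting to [m <= n] makes the maximum finite; it is 0 by default, so
   [N_stage] needs [N 0 <= n]. *)
pose stage n := (\max_(m in early n) m)%N.
have stage_ge M n : (maxn M (N M) <= n)%N -> (M <= stage n)%N.
  rewrite geq_max => /andP[Mn NMn].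
  exact: (@leq_bigmax_cond _ (mem (early n)) (@nat_of_ord _)
    (Ordinal (Mn : (M < n.+1)%N))).
have N_stage n : (N 0%N <= n)%N -> (N (stage n) <= n)%N.
  rewrite /stage => N0n.
  have [|m mn ->] := @eq_bigmax_cond _ (early n) (@nat_of_ord _).
    by apply/card_gt0P; exists ord0.
  exact: mn.
exists (r \o stage).
have eps0 : (r \o stage) @ \oo --> 0.
  apply/cvgrPdist_le => e e0.
  have [M Me] : exists M, r M <= e.
    exists (Num.bound e^-1); rewrite -[leRHS]invrK lef_pV2 ?posrE ?invr_gt0//.
    apply: ltW; apply: (@lt_le_trans _ _ (Num.bound e^-1)%:R).
      by rewrite archi_boundP// invr_ge0 ltW.
    by rewrite ler_nat.
  exists (maxn M (N M)) => //= n /stage_ge Mn.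
  rewrite sub0r normrN (ger0_norm (ltW (r0 _))); apply: (le_trans _ Me).
  by rewrite lef_pV2 ?posrE// ler_nat.
split => //.
apply: (@squeeze_cvge _ _ _ _ (cst 0%E) _ (EFin \o (r \o stage))).
- exists (maxn 1 (N 0%N)) => //= n /=; rewrite geq_max => /andP[n0 N0n].
  by rewrite p0//=; apply: NP; exact: N_stage.
- exact: cvg_cst.
- by apply: cvg_EFin; [near=> n|exact: eps0].
Unshelve. all: by end_near. Qed.

End vanishing.

Section uniform_vanishing.
Context {d} {X : measurableType d} {R : realType}.
Implicit Types (A : algorithm X R) (P : probability (X * R)%type R).

(** The threshold is uniform in the algorithm and the distribution because the
    tail bound depends on them only through [b]. *)
Lemma jackknife_tail_vanishes (alpha e eta : R) (b gamma : nat -> R) :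
  0 < alpha -> alpha < 1 -> 0 < e -> 0 < eta ->
  (forall n, (0 < n)%N -> 0 < gamma n) ->
  (forall eta', 0 < eta' -> exists N, forall n, (N <= n)%N ->
    b n / gamma n <= eta') ->
  exists N, forall n, (N <= n)%N -> forall A P,
    symmetric_algorithm A -> measurable_algorithm A ->
    (beta_out_star A P n.-1 <= (b n)%:E)%E ->
    (iid P n [set D | (alpha + e)%:E <=
       miscoverage P (inflated_jackknife_plus alpha (gamma n) A (n := n)) D]
     <= eta%:E)%E.
Proof.
move=> alpha0 alpha1 e0 eta0 gamma0 bgamma.
pose c := alpha + e; pose c' := alpha + e / 2; pose delta := e / 4.
have c0 : 0 < c by rewrite addr_gt0.
have c'0 : 0 < c' by rewrite addr_gt0// divr_gt0.
have delta0 : 0 < delta by rewrite divr_gt0.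
have [k kP] : exists k, (c' / c) ^+ k <= eta / 2.
  have ratio : (fun k => (c' / c) ^+ k) @ \oo --> (0 : R).
    apply: cvg_expr; rewrite ger0_norm; last by rewrite divr_ge0 ?ltW.
    by rewrite ltr_pdivrMr// mul1r /c /c'; lra.
  have [N NP] := cvg0_eventually_le ratio (divr_gt0 eta0 (ltr0Sn R 1)).
  by exists N; exact: NP.
pose K : R := (k * k.*2)%:R.
have [N1 N1P] : exists N, forall n, (N <= n)%N ->
    b n / gamma n <= (eta / 2 * c ^+ k) * delta / (K + 1).
  apply: bgamma; rewrite divr_gt0 ?ltr_wpDl ?ler0n// mulr_gt0//.
  by rewrite mulr_gt0 ?exprn_gt0// divr_gt0.
have [N2 N2P] : exists N, forall n, (N <= n)%N -> k%:R / n%:R <= delta.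
  exists (Num.bound (k%:R / delta)) => n kn.
  have kdn : k%:R / delta < n%:R.
    apply: (@lt_le_trans _ _ (Num.bound (k%:R / delta))%:R).
      by apply: archi_boundP; rewrite divr_ge0 ?ler0n// ltW.
    by rewrite ler_nat.
  have n0 : 0 < n%:R :> R by apply: le_lt_trans kdn; rewrite divr_ge0 ?ler0n// ltW.
  by rewrite ler_pdivrMr// mulrC -ler_pdivrMr// ltW.
exists (maxn 1 (maxn N1 N2)) => n; rewrite !geq_max => /and3P[n0 /N1P bn /N2P kn].
move=> A P symA mA betab.
have := jackknife_tail_bound k symA mA n0 (ltW alpha0) (ltW alpha1)
  (gamma0 _ n0) delta0 (ltW c0) betab.
rewrite -/c; set q := iid _ _ _ => tail.
have ck0 : 0 < c ^+ k by rewrite exprn_gt0.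
rewrite -(@lee_pmul2l _ (c ^+ k)%:E)//; apply: (le_trans tail).
rewrite -EFinM lee_fin.
have -> : c ^+ k * eta = c ^+ k * (eta / 2) + eta / 2 * c ^+ k by field.
apply: lerD.
  apply: (@le_trans _ _ (c' ^+ k)).
    apply: lerXn2r; rewrite ?nnegrE.
    - by rewrite !addr_ge0 ?divr_ge0 ?ler0n// ltW.
    - exact: ltW.
    by rewrite /c' /delta; rewrite /delta in kn; lra.
  have -> : c' ^+ k = c ^+ k * (c' / c) ^+ k.
    by rewrite -exprMn mulrC divfK ?gt_eqF.
  by rewrite ler_pM2l.
have K0 : 0 <= K by rewrite ler0n.
apply: (@le_trans _ _ (K / delta * (b n / gamma n))).
  rewrite le_eqVlt; apply/orP; left; apply/eqP; rewrite /K; field.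
  by rewrite !gt_eqF// gamma0.
apply: (@le_trans _ _ (K / delta * (eta / 2 * c ^+ k * delta / (K + 1)))).
  by rewrite ler_wpM2l// divr_ge0// ltW.
have -> : K / delta * (eta / 2 * c ^+ k * delta / (K + 1)) =
    (eta / 2 * c ^+ k) * (K / (K + 1)).
  by field; rewrite !gt_eqF// ltr_wpDl.
rewrite ler_piMr//; first by rewrite mulr_ge0 ?ltW// divr_gt0.
by rewrite ler_pdivrMr ?ltr_wpDl// mul1r lerDl.
Qed.

Lemma measurable_miscoverage_ge A P alpha gamma n (c : \bar R) :
  measurable_algorithm A ->
  measurable [set D | (c <=
    miscoverage P (inflated_jackknife_plus alpha gamma A (n := n)) D)%E].
Proof.
move=> mA; under eq_set do rewrite miscoverageE.
rewrite -[X in measurable X]setTI; apply: emeasurable_fun_c_infty => //.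
exact: (measurable_fun_xsection P
  (@measurable_miscovered_set _ _ _ A alpha gamma n mA)).
Qed.

(** Half of the excess [e] pays for the deflation from the interval inflated by
    [gamma n = sqrt (b n / B n)]. *)
Lemma jackknife_plus_tail_vanishes (alpha e eta : R) (b B : nat -> R) :
  0 < alpha -> alpha < 1 -> 0 < e -> 0 < eta ->
  (forall n, (0 < n)%N -> 0 < b n) -> (forall n, (0 < n)%N -> 0 < B n) ->
  (fun n => b n * B n) @ \oo --> 0 ->
  exists N, forall n, (N <= n)%N -> forall A P,
    symmetric_algorithm A -> measurable_algorithm A ->
    bounded_density (B n) P ->
    (beta_out_star A P n.-1 <= (b n)%:E)%E ->
    (iid P n [set D | (alpha + e)%:E <=
       miscoverage P (jackknife_plus alpha A (n := n)) D] <= eta%:E)%E.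
Proof.
move=> alpha0 alpha1 e0 eta0 b0 B0 /cvg0_eventually_le bB.
pose gamma n := Num.sqrt (b n / B n).
have gamma0 n : (0 < n)%N -> 0 < gamma n.
  by move=> n0; rewrite sqrtr_gt0 divr_gt0 ?b0 ?B0.
have gammaB n : (0 < n)%N -> gamma n * B n = Num.sqrt (b n * B n).
  move=> n0; have Bn := B0 n n0.
  have -> : b n * B n = b n / B n * B n ^+ 2 by field; rewrite gt_eqF.
  rewrite sqrtrM ?sqrtr_sqr ?ger0_norm ?(ltW Bn)//.
  by rewrite ltW// divr_gt0// b0.
have bgamma n : (0 < n)%N -> b n / gamma n = Num.sqrt (b n * B n).
  move=> n0; rewrite -gammaB//; apply: (canLR (mulfK _)).
    by rewrite gt_eqF ?gamma0.
  rewrite mulrAC -expr2 sqr_sqrtr ?divfK ?gt_eqF ?B0//.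
  by rewrite divr_ge0// ltW ?b0 ?B0.
have sqrt_small e' : 0 < e' -> exists N, forall n, (N <= n)%N ->
    Num.sqrt (b n * B n) <= e'.
  move=> e'0; have [N NP] := bB (e' ^+ 2) (exprn_gt0 2 e'0).
  exists N => n /NP le2; rewrite -(ger0_norm (ltW e'0)) -sqrtr_sqr.
  exact: ler_wsqrtr.
have bgamma_small e' : 0 < e' -> exists N, forall n, (N <= n)%N ->
    b n / gamma n <= e'.
  move=> /sqrt_small[N NP]; exists (maxn 1 N) => n.
  by rewrite geq_max => /andP[n0 /NP]; rewrite bgamma.
have e20 : 0 < e / 2 by rewrite divr_gt0.
have [N1 N1P] := jackknife_tail_vanishes alpha0 alpha1 e20 eta0 gamma0
  bgamma_small.
have e40 : 0 < e / 4 by rewrite divr_gt0.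
have [N2 N2P] := sqrt_small _ e40.
exists (maxn 1 (maxn N1 N2)) => n; rewrite !geq_max => /and3P[n0 n1 /N2P n2].
move=> A P symA mA dP betab; apply: le_trans (N1P n n1 A P symA mA betab).
apply: le_measure; rewrite ?inE; [exact: measurable_miscoverage_ge..|].
move=> D /= /le_trans cov.
have := cov _ (miscoverage_deflate alpha D mA (ltW (gamma0 n n0)) dP).
rewrite -mulrA gammaB// => {}cov.
rewrite -(@leeD2rE _ (2 * Num.sqrt (b n * B n))%:E)//.
apply: le_trans cov; rewrite -EFinD lee_fin; lra.
Qed.

End uniform_vanishing.

Section witnesses.
Context {d} {X : measurableType d} {R : realType}.

(** Some admissible pair is needed for the suprema to be nonnegative: the supremum
    of the empty set is [-oo]. *)
Definition zero_algorithm : algorithm X R := fun _ => cst 0.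

Lemma symmetric_zero_algorithm : symmetric_algorithm zero_algorithm.
Proof. by []. Qed.

Lemma measurable_zero_algorithm : measurable_algorithm zero_algorithm.
Proof. by move=> n; exact: measurable_cst. Qed.

Lemma beta_out_star_zero_algorithm (P : probability (X * R)%type R) n :
  (beta_out_star zero_algorithm P n <= 0)%E.
Proof.
apply: ge_ereal_sup => _ [m _ <-]; rewrite /beta_out unlock.
by under eq_integral do rewrite /= subrr normr0; rewrite integral0.
Qed.

(** The first coordinate is deterministic and the second uniform on [0, 1/B]. *)
Lemma exists_bounded_density (B : R) : 0 < B ->
  exists P : probability (X * R)%type R, bounded_density B P.
Proof.
move=> B0.
have ab : 0 < B^-1 by rewrite invr_gt0.
have mh : measurable_fun [set: measurableTypeR R] (fun y => (point : X, y : R)).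
  exact: (@measurable_pair1 _ _ X R point).
pose P : probability (X * R)%type R := distribution (uniform_prob ab)
  (HB.pack_for {mfun (measurableTypeR R) >-> (X * R)%type}
    (fun y : measurableTypeR R => (point : X, y : R))
    (isMeasurableFun.Build _ _ (measurableTypeR R) _ _ mh)).
exists P, (fun _ y => uniform_pdf 0 B^-1 y).
have pdf0 y : 0 <= uniform_pdf 0 B^-1 y by exact: uniform_pdf_ge0.
have sup_le x : (sup_density (fun (_ : X) y => uniform_pdf 0 B^-1 y) x <= B%:E)%E.
  apply: ge_ereal_sup => _ [y _ <-]; rewrite lee_fin /uniform_pdf.
  by case: ifP => _; rewrite ?subr0 ?invrK// ltW.
split; last 2 first.
- exact: measurable_cst.
- apply: (@le_trans _ _ (\int[P]_z (cst B%:E z))%E); last first.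
    by rewrite integral_cst// [X in (_ * X)%E]probability_setT mule1.
  apply: ge0_le_integral => //=.
  + move=> z _; apply: le_trans (_ : (uniform_pdf 0 B^-1 0)%:E <= _)%E.
      by rewrite lee_fin.
    by apply: ereal_sup_ubound; exists 0.
split => //.
- exact: (measurableT_comp (measurable_uniform_pdf _ _) measurable_snd).
move=> S C mS mC.
transitivity (uniform_prob ab C *
    uniform_prob ab [set y | S point /\ setT y])%E; last first.
  by rewrite -[RHS]/(\int[P]_(z in S `*` setT) cst (uniform_prob ab C) z)%E
    integral_cst//; exact: measurableX.
rewrite -[LHS]/(uniform_prob ab [set y | S point /\ C y]).
have [Spt|nSpt] := pselect (S point).
  have full (U : set R) : [set y | S point /\ U y] = U.
    by apply/seteqP; split => // y [].
  by rewrite !full [X in (_ * X)%E](probability_setT (uniform_prob ab)) mule1.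
have empty (U : set R) : [set y | S point /\ U y] = set0.
  by apply/seteqP; split => // y [].
by rewrite !empty !measure0 mule0.
Qed.

End witnesses.

(** * The asymptotic guarantees *)

Theorem theorem3p6 (R : realType) (d : measure_display) (X : measurableType d)
    (alpha : R) (alpha_gt0 : 0 < alpha) (alpha_lt1 : alpha < 1) :
  (forall b gamma : nat -> R,
    (forall n, (0 < n)%N -> 0 < b n) ->
    (forall n, (0 < n)%N -> 0 < gamma n) ->
    (fun n => b n / gamma n) @ \oo --> 0 ->
    exists eps : nat -> R, eps @ \oo --> 0 /\
      (fun n => ereal_sup [set p : \bar R |
          exists (A : algorithm X R) (P : probability (X * R)%type R),
            [/\ symmetric_algorithm A,
                measurable_algorithm A,
                (beta_out_star A P n.-1 <= (b n)%:E)%E &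
                p = iid P n [set D | ((alpha + eps n)%:E <=
                  miscoverage P (inflated_jackknife_plus alpha (gamma n) A (n := n)) D)%E]]])
        @ \oo --> 0%E)
  /\
  (forall b B : nat -> R,
    (forall n, (0 < n)%N -> 0 < b n) ->
    (forall n, (0 < n)%N -> 0 < B n) ->
    (fun n => b n * B n) @ \oo --> 0 ->
    exists eps : nat -> R, eps @ \oo --> 0 /\
      (fun n => ereal_sup [set p : \bar R |
          exists (A : algorithm X R) (P : probability (X * R)%type R),
            [/\ symmetric_algorithm A,
                measurable_algorithm A,
                bounded_density (B n) P,
                (beta_out_star A P n.-1 <= (b n)%:E)%E &
                p = iid P n [set D | ((alpha + eps n)%:E <=
                  miscoverage P (jackknife_plus alpha A (n := n)) D)%E]]])
        @ \oo --> 0%E).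
Proof.
split=> [b gamma b0 gamma0 bgamma|b B b0 B0 bB].
- apply: (diagonal_rate (p := fun e n => ereal_sup [set p : \bar R |
      exists (A : algorithm X R) (P : probability (X * R)%type R),
        [/\ symmetric_algorithm A, measurable_algorithm A,
            (beta_out_star A P n.-1 <= (b n)%:E)%E &
            p = iid P n [set D | ((alpha + e)%:E <=
              miscoverage P
                (inflated_jackknife_plus alpha (gamma n) A (n := n)) D)%E]]])).
    move=> e n n0; have [P _] := exists_bounded_density (X := X) (@ltr01 R).
    apply: (le_trans _ (ereal_sup_ubound _)); last first.
      exists (@zero_algorithm _ X R), P; split; last by reflexivity.
      - exact: symmetric_zero_algorithm.
      - exact: measurable_zero_algorithm.
      - apply: le_trans (beta_out_star_zero_algorithm P n.-1) _.
        by rewrite lee_fin ltW// b0.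
    exact: measure_ge0.
  move=> e eta e0 eta0.
  have [N NP] := jackknife_tail_vanishes (X := X) alpha_gt0 alpha_lt1 e0 eta0
    gamma0 (cvg0_eventually_le bgamma).
  exists N => n nN; apply: ge_ereal_sup => _ [A [P [symA mA betab ->]]].
  exact: NP.
- apply: (diagonal_rate (p := fun e n => ereal_sup [set p : \bar R |
      exists (A : algorithm X R) (P : probability (X * R)%type R),
        [/\ symmetric_algorithm A, measurable_algorithm A,
            bounded_density (B n) P, (beta_out_star A P n.-1 <= (b n)%:E)%E &
            p = iid P n [set D | ((alpha + e)%:E <=
              miscoverage P (jackknife_plus alpha A (n := n)) D)%E]]])).
    move=> e n n0; have [P dP] := exists_bounded_density (X := X) (B0 n n0).
    apply: (le_trans _ (ereal_sup_ubound _)); last first.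
      exists (@zero_algorithm _ X R), P; split; last by reflexivity.
      - exact: symmetric_zero_algorithm.
      - exact: measurable_zero_algorithm.
      - exact: dP.
      - apply: le_trans (beta_out_star_zero_algorithm P n.-1) _.
        by rewrite lee_fin ltW// b0.
    exact: measure_ge0.
  move=> e eta e0 eta0.
  have [N NP] := jackknife_plus_tail_vanishes (X := X) alpha_gt0 alpha_lt1 e0
    eta0 b0 B0 bB.
  exists N => n nN; apply: ge_ereal_sup => _ [A [P [symA mA dP betab ->]]].
  exact: NP.
Qed.
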